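(* Let $(\Gamma,\mu)$ be a stochastic dynamical system on $C([0,1])$ such that $$\mu^{\otimes\mathbb N}\Big(\Big\{(g_1,g_2,\ldots)\in\Gamma^{\mathbb N}:\ \sup_{n\ge 1}\bigvee_0^1 g_1g_2\cdots g_n<\infty\Big\}\Big)>0 .$$ Assume that at least one of the following two conditions holds: $(\mathfrak U_1)$ for every $x\in(0,1)$ there exists $g\in\Gamma$ such that $g(x)<x$; $(\mathfrak U_2)$ for every $x\in(0,1)$ there exists $g\in\Gamma$ such that $g(x)>x$. Then, on $(0,1)$, there is at most one $\mu$-invariant Borel probability measure. If additionally $\nu(\{0\})=\nu(\{1\})=0$ for every $\mu$-invariant Borel probability measure $\nu$ on $[0,1]$, then $(\Gamma,\mu)$ is uniquely ergodic.
   Context: $C([0,1])$ denotes the space of all continuous functions $g:[0,1]\to[0,1]$ with the supremum metric. A stochastic dynamical system on $C([0,1])$ is a pair $(\Gamma,\mu)$ where $\mu$ is a Borel probability measure on $C([0,1])$ and $\Gamma=\operatorname{supp}(\mu)$ is its topological support. Products of functions denote composition: $g_1g_2\cdots g_n=g_1\circ g_2\circ\cdots\circ g_n$. $\bigvee_a^b g$ denotes the total variation of $g$ on $[a,b]$, i.e. the supremum of $\sum_{i=1}^n|g(x_i)-g(x_{i-1})|$ over all partitions $a=x_0<x_1<\cdots<x_n=b$ (possibly $+\infty$). A Borel probability measure $\nu$ on $[0,1]$ is $\mu$-invariant ($=\mu$-stationary) if $\nu(A)=\int_\Gamma \nu(g^{-1}(A))\,d\mu(g)$ for every Borel set $A\subset[0,1]$.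 A measure ''on $(0,1)$'' means a probability measure $\nu$ on $[0,1]$ with $\nu((0,1))=1$. $(\Gamma,\mu)$ is uniquely ergodic if there is exactly one $\mu$-invariant Borel probability measure on $[0,1]$. *)

(* Defs.v *)
From HB Require Import structures.
From mathcomp Require Import all_boot all_order all_algebra.
From mathcomp Require Import all_classical all_reals all_analysis.

Set Implicit Arguments.
Unset Strict Implicit.
Unset Printing Implicit Defensive.
Import Order.TTheory GRing.Theory Num.Theory.
Import numFieldNormedType.Exports.

Local Open Scope classical_set_scope.
Local Open Scope ring_scope.

Definition I01 (R : realType) : Type := set_type `[0 : R, 1]%classic.

Section unit_interval.
Variable R : realType.

HB.instance Definition _ :=
  PseudoMetric.copy (I01 R) (set_type `[0 : R, 1]%classic).

Definition I01_val (x : I01 R) : R := \val x.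

Lemma I01_valP (x : I01 R) : 0 <= I01_val x <= 1.
Proof. by have := set_valP x; rewrite /= in_itv. Qed.

Lemma I01_val_inj : injective I01_val.
Proof. exact: val_inj. Qed.

Lemma I01_0_subproof : (0 : R) \in `[0 : R, 1]%classic.
Proof. by rewrite inE /= in_itv /= lexx ler01. Qed.

Definition I01_0 : I01 R := exist _ 0 I01_0_subproof.

HB.instance Definition _ := isPointed.Build (I01 R) I01_0.

End unit_interval.

Definition C01 (R : realType) : Type := continuousType (I01 R) (I01 R).

Section sup_metric.
Variable R : realType.

HB.instance Definition _ :=
  Choice.copy (C01 R) (continuousType (I01 R) (I01 R)).

HB.instance Definition _ := isPointed.Build (C01 R) (@idfun (I01 R)).

Implicit Types f g h : C01 R.

Definition C01_dist f g : R :=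
  sup [set `|I01_val (f x) - I01_val (g x)| | x in [set: I01 R]].

Lemma C01_dist_ub f g x : `|I01_val (f x) - I01_val (g x)| <= C01_dist f g.
Proof.
apply: ub_le_sup; last by exists x.
exists 1 => _ [y _ <-].
have := I01_valP (f y); have := I01_valP (g y) => /andP[? ?] /andP[? ?].
rewrite ler_norml; apply/andP; split; first by rewrite lerBrDl lerBlDr ler_wpDl.
by rewrite lerBlDr ler_wpDr.
Qed.

Lemma C01_dist_le f g (c : R) :
  (forall x, `|I01_val (f x) - I01_val (g x)| <= c) -> C01_dist f g <= c.
Proof.
move=> H; apply: ge_sup; last by move=> _ [x _ <-].
by exists `|I01_val (f point) - I01_val (g point)|, point.
Qed.

Lemma C01_distxx f : C01_dist f f = 0.
Proof.
apply/eqP; rewrite eq_le; apply/andP; split.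
  by apply: C01_dist_le => x; rewrite subrr normr0.
exact: le_trans (normr_ge0 _) (C01_dist_ub f f point).
Qed.

Lemma C01_dist_eq0 f g : C01_dist f g = 0 -> f = g.
Proof.
move=> fg0; apply/continuousEP => x; apply: I01_val_inj; apply/eqP.
by rewrite -subr_eq0 -normr_le0 -fg0 C01_dist_ub.
Qed.

Lemma C01_dist_sym f g : C01_dist f g = C01_dist g f.
Proof.
by rewrite /C01_dist; congr sup; apply: eq_imagel => x _; rewrite distrC.
Qed.

Lemma C01_dist_triangle g f h : C01_dist f h <= C01_dist f g + C01_dist g h.
Proof.
apply: C01_dist_le => x; apply: le_trans (ler_distD (I01_val (g x)) _ _) _.
by rewrite lerD// C01_dist_ub.
Qed.

HB.instance Definition _ := @isMetric.Build R (C01 R) C01_dist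
  C01_distxx C01_dist_eq0 C01_dist_sym C01_dist_triangle.

End sup_metric.

Notation borel T := (g_sigma_algebraType (@open T)).

Section sequences_space.
Context d (T : measurableType d).

Definition coordinate_events : set (set (nat -> T)) :=
  [set A | exists n (B : set T), measurable B /\ A = [set w | B (w n)]].

Definition seq_space : Type := g_sigma_algebraType coordinate_events.

HB.instance Definition _ := Measurable.on seq_space.

(* [P] is the product measure mu^{(x) N}: by the pi-lambda theorem these
   values on the finite-dimensional rectangles determine it on the product
   sigma-algebra. *)
Definition is_product_measure (R : realType) (mu : probability T R)
    (P : probability seq_space R) : Prop :=
  forall (n : nat) (B : nat -> set T), (forall i, measurable (B i)) ->
    P [set w : nat -> T | forall i, (i < n)%N -> B i (w i)] =
    (\prod_(i < n) mu (B i))%E.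

End sequences_space.

Section stochastic_dynamical_system.
Variable R : realType.

Definition supp (mu : probability (borel (C01 R)) R) : set (C01 R) :=
  [set g | forall U : set (C01 R), open_nbhs g U -> (0 < mu U)%E].

(* Sequences (g_1, g_2, ...) are indexed from 0, so that
   [prefix_comp g n] is the product g_1 g_2 ... g_n. *)
Fixpoint prefix_comp (g : nat -> C01 R) (n : nat) : I01 R -> I01 R :=
  if n is m.+1 then prefix_comp g m \o g m else idfun.

(* [total_variation] is about functions on the whole of [R]; the value 0
   chosen outside of [0, 1] is not seen by partitions of [0, 1]. *)
Definition I01_variation (f : I01 R -> I01 R) : \bar R :=
  total_variation 0 1 (valL_ 0 (@I01_val R \o f : set_type `[0 : R, 1]%classic -> R)).

Definition bounded_prefix_variation (mu : probability (borel (C01 R)) R) :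
    set (nat -> C01 R) :=
  [set g | (forall n, supp mu (g n)) /\
    (ereal_sup [set I01_variation (prefix_comp g n) | n in [set n | (1 <= n)%N]]
       < +oo)%E].

Definition invariant_measure (mu : probability (borel (C01 R)) R)
    (nu : probability (borel (I01 R)) R) : Prop :=
  forall A : set (borel (I01 R)), measurable A ->
    nu A = (\int[mu]_(g in supp mu) nu ((g : C01 R) @^-1` A))%E.

(* Measures are functions on all sets, whose values on non-measurable sets are
   meaningless: this is equality as Borel measures. *)
Definition same_borel_measure (nu1 nu2 : probability (borel (I01 R)) R) : Prop :=
  forall A : set (borel (I01 R)), measurable A -> nu1 A = nu2 A.

Definition open_I01 : set (I01 R) := [set x | 0 < I01_val x < 1].

Definition uniquely_ergodic (mu : probability (borel (C01 R)) R) : Prop :=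
  exists nu, invariant_measure mu nu /\
    forall nu', invariant_measure mu nu' -> same_borel_measure nu' nu.

End stochastic_dynamical_system.

(* Main.v *)
(* Let nu1 <> nu2 be invariant measures on (0, 1).  The Jordan parts s1, s2 of
   nu1 - nu2 are again invariant and live on disjoint Borel sets, which can be
   shrunk to sets D1, D2 at distance d > 0 carrying almost all of s1 and s2.
   By the maximal ergodic inequality, the points whose random orbits spend, on
   average, almost all their time in D1 contain a set B1 of positive s1-measure
   that orbits almost surely never leave; similarly B2 for s2 and D2.  So s1
   restricted to B1 is invariant, and under (U1) or (U2) the support of an
   invariant measure without mass at the endpoints accumulates at 0,
   respectively at 1.  Hence there are arbitrarily long monotone chains
   x_1, y_1, x_2, y_2, ... with x_i in B1 and y_i in B2.  For fixed n,
   g_1 ... g_n has the law of the forward product, so for some n most pairs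
   satisfy g_1 ... g_n (x_i) in D1 and g_1 ... g_n (y_i) in D2 with probability
   close to 1, which forces the variation to be at least d times half the length
   of the chain: a contradiction with the bounded variation, which has positive
   probability.  Existence is the Krylov-Bogoliubov argument. *)

From HB Require Import structures.
Require Import Defs.
From mathcomp Require Import all_boot all_order all_algebra.
From mathcomp Require Import all_classical all_reals all_analysis.
From mathcomp Require Import measurable_realfun interval_inference ring lra.
Import Order.TTheory GRing.Theory Num.Theory.
Import numFieldNormedType.Exports.

Local Open Scope classical_set_scope.
Local Open Scope ring_scope.
Set Implicit Arguments.
Unset Strict Implicit.
Unset Printing Implicit Defensive.

(** * Random maps, excessive measures and the maximal inequality *)

(** The boundedness hypothesis concerns products in which each new map enters on the right; these do
    not follow an orbit and agree with the random orbit only in law, at one fixed time. Hence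
    everything is read off expectations at single times. The maximal inequality fits this: for each
    point of B1 it bounds the expected time spent outside D1 before time [N] by [k + N * e], for all
    [N] at once. The constants [k] of finitely many points are absorbed by a large [N], so that a
    whole chain is handled on a common time scale. As bounded variation has only some probability p
    > 0, the rate [e] must be small against p. For a chain of M pairs, the bounded event forces at
    least M/2 failures at each time, an expectation of at least Mp/2, while 2M points failing at
    average rate below 2e give less than 4Me; [e = p / 16] separates the two. Invariance enters as a
    one-sided inequality, which is easily inherited by Jordan parts and by restrictions to absorbing
    sets. Variation is computed along uniform grids, so that the events involved depend on countably
    many evaluations. *)

Section markov_operator.
Local Open Scope ereal_scope.
Context d d' (X : measurableType d) (C : measurableType d') (R : realType).
Variables (mu : probability C R) (ev : C * X -> X).
Hypothesis mev : measurable_fun [set: C * X] ev.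

Definition markov_op (f : X -> \bar R) (x : X) : \bar R := \int[mu]_g f (ev (g, x)).

Lemma markov_op_ge0 f : (forall x, 0 <= f x) -> forall x, 0 <= markov_op f x.
Proof. by move=> f0 x; apply: integral_ge0. Qed.

Lemma measurable_ev1 (f : X -> \bar R) x : measurable_fun [set: X] f ->
  measurable_fun [set: C] (fun g => f (ev (g, x))).
Proof.
by move=> mf; apply: measurableT_comp => //; apply: (measurableT_comp mev);
  exact: pair2_measurable.
Qed.

Lemma measurable_markov_op f : measurable_fun [set: X] f -> (forall x, 0 <= f x) ->
  measurable_fun [set: X] (markov_op f).
Proof.
move=> mf f0.
apply: (@measurable_fun_fubini_tonelli_G _ _ _ _ R mu (f \o ev)) => //.
  exact: measurableT_comp.
by move=> x; exact: f0.
Qed.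

Lemma le_markov_op f1 f2 : measurable_fun [set: X] f1 -> measurable_fun [set: X] f2 ->
  (forall x, 0 <= f1 x) -> (forall x, f1 x <= f2 x) ->
  forall x, markov_op f1 x <= markov_op f2 x.
Proof.
move=> m1 m2 f10 f12 x; apply: ge0_le_integral => //.
- exact: measurable_ev1.
- exact: measurable_ev1.
Qed.

Lemma markov_op_cst (r : \bar R) x : markov_op (cst r) x = r.
Proof. by rewrite /markov_op integral_cst//= probability_setT mule1. Qed.

(* Both sides have the same total mass, so this one-sided condition amounts to
   invariance. *)
Definition excessive (nu : {finite_measure set X -> \bar R}) :=
  forall A, measurable A -> (mu \x nu) (ev @^-1` A) <= nu A.

Lemma measurable_preimage_ev A : measurable A -> measurable (ev @^-1` A).
Proof. by move=> mA; rewrite -[X in measurable X]setTI; exact: mev. Qed.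

Lemma integral_markov_op (nu : {finite_measure set X -> \bar R}) f :
  measurable_fun [set: X] f -> (forall x, 0 <= f x) ->
  \int[nu]_x markov_op f x = \int[mu \x nu]_z f (ev z).
Proof.
move=> mf f0; rewrite /markov_op -(@fubini_tonelli2 _ _ _ _ R mu nu (f \o ev))//.
  exact: measurableT_comp.
by move=> x; exact: f0.
Qed.

Lemma excessive_integral (nu : {finite_measure set X -> \bar R}) f :
  excessive nu -> measurable_fun [set: X] f -> (forall x, 0 <= f x) ->
  \int[nu]_x markov_op f x <= \int[nu]_x f x.
Proof.
move=> exc mf f0; rewrite integral_markov_op//.
rewrite -[X in \int[_]_(_ in X) _](preimage_setT ev).
rewrite -(@ge0_integral_pushforward _ _ _ _ _ ev mev (mu \x nu)%E setT f)//.
exact: ge0_le_measure_integral.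
Qed.

(** * Maximal inequality and absorbing sets *)

Section maximal_inequality.
Variables (f : X -> \bar R) (lam : R).
Hypothesis mf : measurable_fun [set: X] f.
Hypothesis f0 : forall x, 0 <= f x.
Hypothesis f1 : forall x, f x <= 1.
Hypothesis lam0 : (0 < lam)%R.

(* [garsia n] is the positive part of the maximum over [1 <= k <= n] of
   [\sum_(i < k) iter i markov_op f - k * lam], up to replacing the maximum of
   averages by the average of maxima, which only increases it. *)
Fixpoint garsia (n : nat) : X -> \bar R :=
  if n is m.+1 then fun x => maxe 0 (f x + markov_op (garsia m) x - lam%:E)
  else cst 0.

Definition garsia_pos n := [set x | 0 < garsia n x].

Lemma garsia_ge0 n x : 0 <= garsia n x.
Proof. by case: n => // n; rewrite /= le_max lexx. Qed.

Lemma measurable_garsia n : measurable_fun [set: X] (garsia n).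
Proof.
elim: n => [|n IH] /=; first exact: measurable_cst.
apply: measurable_maxe => //; apply: emeasurable_funD => //.
apply: emeasurable_funD => //; apply: measurable_markov_op => //.
exact: garsia_ge0.
Qed.

Lemma garsiaS n x : garsia n x <= garsia n.+1 x.
Proof.
elim: n x => [|n IH] x; first exact: (garsia_ge0 1).
rewrite /= ge_max le_max lexx /= le_max; apply/orP; right.
by rewrite leeD2r// leeD2l//; apply: le_markov_op => //;
  [exact: measurable_garsia|exact: (measurable_garsia n.+1)|exact: garsia_ge0].
Qed.

Lemma garsia_nd x : nondecreasing_seq (garsia ^~ x).
Proof. by apply/nondecreasing_seqP => n; exact: garsiaS. Qed.

Lemma garsia_le n x : garsia n x <= n%:R%:E.
Proof.
elim: n x => [|n IH] x //=; rewrite ge_max lee_fin ler0n/=.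
rewrite EFinN leeBlDr//; apply: (@le_trans _ _ (1 + n%:R%:E)).
  apply: leeD => //; rewrite -[leRHS](markov_op_cst _ x).
  by apply: le_markov_op => //; [exact: measurable_garsia|exact: garsia_ge0].
by rewrite -EFinD -EFinD lee_fin -natr1 addrC lerDl ltW.
Qed.

(** Where [garsia n] is positive, the maximum in its recursion is attained by the second term, and
    monotonicity in [n] replaces the preceding index by [n] under [markov_op]. Elsewhere [garsia n]
    vanishes and the right side is nonnegative. *)
Lemma garsia_step n x :
  garsia n x + lam%:E * (\1_(garsia_pos n) x)%:E <=
  f x + markov_op (garsia n) x.
Proof.
have U0 := markov_op_ge0 (garsia_ge0 n) x.
rewrite indicE; have [/set_mem gt0|/negP ngt0] := boolP (_ \in _).
  have {}gt0 : 0 < garsia n x := gt0.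
  rewrite mule1; case: n gt0 U0 => [|n]; first by rewrite /= ltxx.
  move=> gt0 U0; have -> : garsia n.+1 x = f x + markov_op (garsia n) x - lam%:E.
    by move: gt0; rewrite /= lt_max ltxx/= => /ltW/max_idPr.
  rewrite subeK// leeD2l//; apply: le_markov_op => //;
    [exact: measurable_garsia|exact: (measurable_garsia n.+1)|exact: garsia_ge0|].
  exact: garsiaS.
have : garsia n x <= 0.
  by rewrite leNgt; apply/negP => gt0; apply: ngt0; exact/mem_set.
by rewrite mule0 adde0 => /le_trans; apply; rewrite adde_ge0.
Qed.

Variable nu : {finite_measure set X -> \bar R}.
Hypothesis exc : excessive nu.

Lemma measurable_garsia_gt0 n : measurable (garsia_pos n).
Proof.
by rewrite -[X in measurable X]setTI; exact/emeasurable_fun_o_infty/measurable_garsia.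
Qed.

(** On integrating [garsia_step], excessiveness bounds the integral of [markov_op (garsia n)] by
    that of [garsia n], which is finite by [garsia_le] and cancels. *)
Lemma garsia_maximal n :
  lam%:E * nu (garsia_pos n) <= \int[nu]_x f x.
Proof.
have mg := measurable_garsia n; have g0 := garsia_ge0 n.
have mE := measurable_garsia_gt0 n.
have mi : measurable_fun [set: X]
    (fun x => lam%:E * (\1_(garsia_pos n) x)%:E).
  by apply: measurable_funeM; apply/measurable_EFinP; exact: measurable_indic.
have i0 x : 0 <= lam%:E * (\1_(garsia_pos n) x)%:E.
  by rewrite mule_ge0// lee_fin// ltW.
have fin : \int[nu]_x garsia n x \is a fin_num.
  rewrite ge0_fin_numE; last exact: integral_ge0.
  apply: (@le_lt_trans _ _ (\int[nu]_x cst n%:R%:E x)).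
    by apply: ge0_le_integral => // x _; exact: garsia_le.
  by rewrite integral_cst// lte_mul_pinfty// ?lee_fin// fin_num_fun_lty//;
    exact: fin_num_measure.
rewrite -(leeD2lE _ _ fin).
have -> : \int[nu]_x garsia n x + lam%:E * nu (garsia_pos n) =
    \int[nu]_x (garsia n x + lam%:E * (\1_(garsia_pos n) x)%:E).
  rewrite ge0_integralD//; congr (_ + _).
  rewrite ge0_integralZl_EFin//; last 2 first.
  - by apply/measurable_EFinP; exact: measurable_indic.
  - exact: ltW.
  by rewrite integral_indic// setIT.
apply: (@le_trans _ _ (\int[nu]_x (f x + markov_op (garsia n) x))).
  apply: ge0_le_integral => //.
  - by move=> x _; rewrite adde_ge0.
  - exact: emeasurable_funD.
  - by apply: emeasurable_funD => //; exact: measurable_markov_op.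
  - by move=> x _; exact: garsia_step.
rewrite ge0_integralD//; last 2 first.
- by move=> x _; exact: markov_op_ge0.
- exact: measurable_markov_op.
by rewrite addeC leeD2r// excessive_integral.
Qed.

(** The points from which the expected sums of [f] exceed the linear rate [lam] by a bounded amount
    only, see [sum_iter_markov_op]. With [f] the indicator of the complement of D1 or D2, this is
    the set B1 or B2. *)
Definition garsia_bounded := [set x | limn (garsia ^~ x) < +oo].

Lemma measurable_lim_garsia :
  measurable_fun [set: X] (fun x => limn (garsia ^~ x)).
Proof.
apply: (emeasurable_fun_cvg garsia) => [n|x _]; first exact: measurable_garsia.
by apply: ereal_nondecreasing_is_cvgn; exact: garsia_nd.
Qed.

Lemma measurable_garsia_bounded : measurable garsia_bounded.
Proof.
rewrite -[X in measurable X]setTI.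
exact: emeasurable_fun_infty_o measurable_lim_garsia _.
Qed.

Lemma garsia_lim n x : garsia n x <= limn (garsia ^~ x).
Proof.
rewrite (cvg_lim _ (ereal_nondecreasing_cvgn (@garsia_nd x)))//.
by apply: ereal_sup_ubound; exists n.
Qed.

(** A point outside [garsia_bounded] has [garsia n] positive for some [n]. Were [garsia_bounded]
    null, the increasing sets [garsia_pos n] would exhaust the mass, and [garsia_maximal] would give
    in the limit the reverse of the assumed inequality. *)
Lemma garsia_bounded_measure : \int[nu]_x f x < lam%:E * nu [set: X] ->
  0 < nu garsia_bounded.
Proof.
move=> fsmall; rewrite lt_neqAle measure_ge0 andbT; apply/negP => /eqP nuB0.
pose E n := (garsia_pos n).
have mE n : measurable (E n) := measurable_garsia_gt0 n.
have mUE : measurable (\bigcup_n E n) by exact: bigcup_measurable.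
have cE : nu (E n) @[n --> \oo] --> nu (\bigcup_n E n).
  apply: nondecreasing_cvg_mu => //.
  move=> m n mn; apply/subsetPset => x /= /lt_le_trans; apply.
  exact: garsia_nd.
have sub : nu [set: X] <= nu (garsia_bounded `|` \bigcup_n E n).
  apply: le_measure; rewrite ?inE//.
    by apply: measurableU => //; exact: measurable_garsia_bounded.
  move=> x _; have [[n gn]|nE] := pselect (exists n, 0 < garsia n x).
    by right; exists n.
  left; rewrite /garsia_bounded /=; have -> : garsia ^~ x = cst 0.
    apply/funext => n; apply/eqP; rewrite eq_le garsia_ge0 andbT leNgt.
    by apply/negP => ?; apply: nE; exists n.
  by rewrite lim_cst// ltry.
have : lam%:E * nu (\bigcup_n E n) <= \int[nu]_x f x.
  have c : lam%:E * nu (E n) @[n --> \oo] --> lam%:E * nu (\bigcup_n E n).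
    by apply: cvgeZl.
  rewrite -(cvg_lim _ c)//; apply: lime_le; first by apply/cvg_ex; eexists; exact: c.
  by apply: nearW => n; exact: garsia_maximal.
apply/negP; rewrite -ltNge; apply: lt_le_trans fsmall _.
rewrite lee_pmul2l//; apply: le_trans sub _.
apply: le_trans (measureU2 _ _ _) _ => //; first exact: measurable_garsia_bounded.
by rewrite [X in X + _](_ : _ = 0)// add0e.
Qed.

(** The recursion gives [markov_op (garsia n) x <= garsia n.+1 x + lam], which stays below a finite
    bound. By monotone convergence the limit of [garsia] is integrable over the random successor of
    [x], hence almost surely finite there. Having the expectation inside the maximum is what makes
    this work. *)
Lemma garsia_bounded_absorbing x : garsia_bounded x ->
  mu [set g | ~ garsia_bounded (ev (g, x))] = 0.
Proof.
move=> Bx.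
have fle n : markov_op (garsia n) x <= limn (garsia ^~ x) + lam%:E.
  apply: (@le_trans _ _ (garsia n.+1 x + lam%:E)); last by rewrite leeD2r// garsia_lim.
  rewrite -leeBlDr//= le_max; apply/orP; right.
  by rewrite leeD2r// leeDr.
have mgx n : measurable_fun [set: C] (fun g => garsia n (ev (g, x))).
  by apply: measurable_ev1; exact: measurable_garsia.
have mlg : measurable_fun [set: C] (fun g => limn (garsia ^~ (ev (g, x)))).
  exact: measurable_ev1 measurable_lim_garsia.
have lim0 y : 0 <= limn (garsia ^~ y).
  exact: le_trans (garsia_ge0 0 y) (garsia_lim _ _).
have int : mu.-integrable setT (fun g => limn (garsia ^~ (ev (g, x)))).
  apply/integrableP; split => //.
  under eq_integral do rewrite gee0_abs//.
  rewrite (@monotone_convergence _ _ R mu setT measurableT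
    (fun n g => garsia n (ev (g, x))))//; last 2 first.
  - by move=> n g _; exact: garsia_ge0.
  - by move=> g _; exact: garsia_nd.
  apply: (@le_lt_trans _ _ (limn (garsia ^~ x) + lam%:E)).
    apply: lime_le; last by apply: nearW => n; exact: fle.
    apply: ereal_nondecreasing_is_cvgn; apply/nondecreasing_seqP => n.
    by apply: le_markov_op; [exact: measurable_garsia|exact: measurable_garsia|
      exact: garsia_ge0|exact: garsiaS].
  by rewrite lte_add_pinfty// ltry.
have [N [mN N0 sN]] := integrable_ae measurableT int.
apply/eqP; rewrite eq_le measure_ge0 andbT -N0; apply: le_measure; rewrite ?inE//.
  rewrite -[X in measurable X]setTI.
  have : measurable_fun [set: C] (fun g => ev (g, x)).
    by apply: (measurableT_comp mev); exact: pair2_measurable.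
  move=> /(_ measurableT (~` garsia_bounded)); apply; apply: measurableC.
  exact: measurable_garsia_bounded.
move=> g /= nB; apply: sN => /= /(_ Logic.I) fin; apply: nB.
by rewrite /garsia_bounded /= ltey_eq fin.
Qed.

(** For [f] the indicator of a set, the left side is the expected number of visits to it before time
    [N]. The induction splits off the first term and applies [markov_op] to the bound for the
    others, reproducing the recursion of [garsia]. *)
Lemma sum_iter_markov_op N x :
  \sum_(n < N) iter n markov_op f x <= garsia N x + (N%:R * lam)%:E.
Proof.
have it0 n y : 0 <= iter n markov_op f y.
  by elim: n y => //= n IH y; exact: markov_op_ge0.
have mit n : measurable_fun [set: X] (iter n markov_op f).
  by elim: n => //= n IH; apply: measurable_markov_op.
elim: N x => [|N IH] x; first by rewrite big_ord0 mul0r adde0.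
rewrite big_ord_recl/=.
rewrite [X in _ + X](_ : _ =
    markov_op (fun y => \sum_(n < N) iter n markov_op f y) x); last first.
  rewrite /markov_op ge0_integral_sum// => n.
  exact: measurable_ev1.
apply: (@le_trans _ _ (f x + (markov_op (garsia N) x + (N%:R * lam)%:E))).
  rewrite leeD2l//.
  have -> : markov_op (garsia N) x + (N%:R * lam)%:E =
      markov_op (fun y => garsia N y + (N%:R * lam)%:E) x.
    rewrite /markov_op ge0_integralD//; last 3 first.
    - by move=> g _; exact: garsia_ge0.
    - by apply: measurable_ev1; exact: measurable_garsia.
    - by move=> g _; rewrite lee_fin mulr_ge0// ltW.
    by rewrite integral_cst//= probability_setT mule1.
  apply: le_markov_op => //.
  - exact: emeasurable_sum.
  - by apply: emeasurable_funD; [exact: measurable_garsia|exact: measurable_cst].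
  - by move=> y; apply: sume_ge0.
rewrite /= -natr1 mulrDl mul1r (addrC (_ * _)%R) EFinD !addeA leeD2r//.
by rewrite -leeBlDr// le_max lexx orbT.
Qed.

End maximal_inequality.


(** Mass starting in [B] almost surely stays in [B], so what reaches [A] from [B] reaches [A] within
    [B], up to a null set. *)
Lemma excessive_restr (nu : {finite_measure set X -> \bar R}) B
    (mB : measurable B) (fB : nu B < +oo) : excessive nu ->
  (forall x, B x -> mu [set g | ~ B (ev (g, x))] = 0) ->
  excessive (mfrestr mB fB).
Proof.
move=> exc absB A mA.
have mXB : measurable ([set: C] `*` B) by exact: measurableX.
have -> : (mu \x mfrestr mB fB) (ev @^-1` A) =
    (mu \x nu) (ev @^-1` A `&` ([set: C] `*` B)).
  apply: eq_integral => g _; rewrite /= /mfrestr /mrestr; congr (nu _).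
  by apply/seteqP; split=> x; rewrite /xsection /= !inE /=; tauto.
apply: (@le_trans _ _ ((mu \x nu) (ev @^-1` (A `&` B) `|`
    (ev @^-1` (~` B) `&` ([set: C] `*` B)))%E)).
  apply: le_measure; rewrite ?inE.
  - by apply: measurableI => //; exact: measurable_preimage_ev.
  - apply: measurableU; first by apply: measurable_preimage_ev; exact: measurableI.
    by apply: measurableI => //; apply: measurable_preimage_ev; exact: measurableC.
  - move=> [g x] /= [Ax [_ Bx]].
    by have [?|?] := pselect (B (ev (g, x))); [left|right].
apply: (le_trans (measureU2 _ _ _)).
- by apply: measurable_preimage_ev; exact: measurableI.
- by apply: measurableI => //; apply: measurable_preimage_ev; exact: measurableC.
rewrite [X in _ + X](_ : _ = 0) ?adde0; first exact/exc/measurableI.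
set D := _ `&` _.
have mD : measurable D.
  by apply: measurableI => //; apply: measurable_preimage_ev; exact: measurableC.
(* Absorption is known for each [x] separately, so the order of integration is exchanged to see that
   [D] is null. *)
rewrite (_ : _ D = (mu \x^ nu) D).
  apply: integral0_eq => x _ /=; have [Bx|nBx] := pselect (B x).
    rewrite -[RHS](absB x Bx); congr (mu _); apply/seteqP.
    by split=> g; rewrite /ysection /D /= inE /=; tauto.
  rewrite [X in mu X](_ : _ = set0) ?measure0//; apply/seteqP.
  by split=> // g; rewrite /ysection /D /= inE /=; tauto.
by apply: product_measure_unique => //= E F mE mF; rewrite product_measure2E.
Qed.

End markov_operator.

(** * Jordan parts of a difference of invariant measures *)

Section singular_parts.
Local Open Scope ereal_scope.
Context d d' (X : measurableType d) (C : measurableType d') (R : realType).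
Variables (mu : probability C R) (ev : C * X -> X).
Hypothesis mev : measurable_fun [set: C * X] ev.

Definition stationary (nu : probability X R) :=
  forall A, measurable A -> (mu \x nu) (ev @^-1` A) = nu A.

(* Since [nu1 - nu2 <= s] with equality on subsets of [P], invariance gives
   [s A <= (mu \x s) (ev @^-1` A)] for every [A]; comparing the total masses
   with that of the complement of [A] reverses the inequality. *)
Lemma excessive_positive_part (nu1 nu2 : probability X R)
    (s : {finite_measure set X -> \bar R}) P :
  measurable P -> stationary nu1 -> stationary nu2 ->
  (forall A, measurable A -> nu1 A <= nu2 A + s A) ->
  (forall A, measurable A -> nu2 (A `&` P) + s A = nu1 (A `&` P)) ->
  excessive mu ev s.
Proof.
move=> mP st1 st2 le12 eq12.
have mE A : measurable A -> measurable (ev @^-1` A) := measurable_preimage_ev mev (A := A).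
have sub A : measurable A -> s A <= (mu \x s) (ev @^-1` A).
  move=> mA; have mAP : measurable (A `&` P) by exact: measurableI.
  apply: (@le_trans _ _ ((mu \x s) (ev @^-1` (A `&` P)))); last first.
    by apply: le_measure; rewrite ?inE//; [exact: mE|exact: mE|move=> x []].
  rewrite -(@leeD2lE _ (nu2 (A `&` P))); last exact: fin_num_measure.
  rewrite eq12// -st1// -st2// /product_measure1/=.
  have mx (m : {finite_measure set X -> \bar R}) :
      measurable_fun [set: C] (fun g => m (xsection (ev @^-1` (A `&` P)) g)).
    exact: measurable_fun_xsection (mE _ mAP).
  have mxs g : measurable (xsection (ev @^-1` (A `&` P)) g).
    exact: measurable_xsection (mE _ mAP).
  rewrite -ge0_integralD//.
  apply: ge0_le_integral => //.
  - by apply: emeasurable_funD; [exact: (mx nu2)|exact: (mx s)].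
  - by move=> g _; exact: le12.
move=> A mA; have mCA := measurableC mA.
have tot : (mu \x s) [set: C * X] = s [set: X].
  by rewrite -setXTT product_measure1E//= probability_setT mul1e.
have finA : s (~` A) \is a fin_num by exact: fin_num_measure.
have dis : (mu \x s) (ev @^-1` A) + (mu \x s) (ev @^-1` (~` A)) = s A + s (~` A).
  rewrite -measureU//; last 3 first.
  - exact: mE.
  - exact: mE.
  - by rewrite -preimage_setI setICr preimage_set0.
  rewrite -preimage_setU setUv preimage_setT -measureU//; last exact: setICr.
  by rewrite setUv; exact: tot.
by rewrite -(leeD2rE _ _ finA) -dis leeD2l// sub.
Qed.

(** The two parts come from a Hahn decomposition of [nu1 - nu2]. The bounds by [nu1] and [nu2] serve
    to carry the absence of mass at the endpoints over to the parts. *)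
Lemma singular_excessive_parts (nu1 nu2 : probability X R) A0 :
  stationary nu1 -> stationary nu2 -> measurable A0 -> nu1 A0 != nu2 A0 ->
  exists (s1 s2 : {finite_measure set X -> \bar R}) P,
    [/\ measurable P, excessive mu ev s1 & excessive mu ev s2] /\
    [/\ s1 (~` P) = 0, s2 P = 0, 0 < s1 [set: X] & 0 < s2 [set: X]] /\
    (forall A, measurable A -> s1 A <= nu1 A) /\
    (forall A, measurable A -> s2 A <= nu2 A).
Proof.
move=> st1 st2 mA0 neq.
pose sg : {charge set X -> \bar R} :=
  cadd (charge_of_finite_measure nu1) (cscale (-1) (charge_of_finite_measure nu2)).
have sgE A : sg A = nu1 A - nu2 A by rewrite /sg/= /cadd/= cscaleN1.
have [P [N PN]] := Hahn_decomposition sg.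
have [[mP posP] [mN negN] PNT PN0] := PN.
have NE : N = ~` P.
  apply/seteqP; split=> x.
    by move=> Nx Px; have : (P `&` N) x by []; rewrite PN0.
  by move=> nPx; have [//|] : (P `|` N) x by rewrite PNT.
have fin1 A : measurable A -> nu1 A \is a fin_num := fun mA => fin_num_measure nu1 A mA.
have fin2 A : measurable A -> nu2 A \is a fin_num := fun mA => fin_num_measure nu2 A mA.
pose s1 : {finite_measure set X -> \bar R} := jordan_pos PN.
pose s2 : {finite_measure set X -> \bar R} := jordan_neg PN.
have s1E A : measurable A -> s1 A = nu1 (A `&` P) - nu2 (A `&` P).
  move=> mA; rewrite -sgE /s1 /= /jordan_pos /measure_of_charge /= cjordan_posE.
  by rewrite /crestr0 mem_set.
have s2E A : measurable A -> s2 A = nu2 (A `&` N) - nu1 (A `&` N).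
  move=> mA; have mAN := measurableI _ _ mA mN.
  rewrite /s2 /= /jordan_neg /measure_of_charge /= cjordan_negE.
  rewrite /crestr0 mem_set// /crestr -/sg sgE oppeB ?fin_num_adde_defl ?fin_numN ?fin2//.
  by rewrite addeC.
have dec A : measurable A -> nu1 A + s2 A = nu2 A + s1 A.
  move=> mA; have := jordan_decomp PN mA.
  rewrite sgE /cadd /= cscaleN1 -/s1 -/s2 => e.
  have fs : s2 A \is a fin_num by exact: fin_num_measure.
  rewrite -[nu1 A](@subeK _ _ (nu2 A)) ?fin2// e.
  rewrite -addeA (addeC (nu2 A)) addeA subeK//.
  by rewrite addeC.
have eq1 A : measurable A -> nu2 (A `&` P) + s1 A = nu1 (A `&` P).
  by move=> mA; rewrite s1E// addeC subeK// fin2//; exact: measurableI.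
have eq2 A : measurable A -> nu1 (A `&` N) + s2 A = nu2 (A `&` N).
  by move=> mA; rewrite s2E// addeC subeK// fin1//; exact: measurableI.
have le1 A : measurable A -> nu1 A <= nu2 A + s1 A.
  by move=> mA; rewrite -dec// leeDl.
have le2 A : measurable A -> nu2 A <= nu1 A + s2 A.
  by move=> mA; rewrite dec// leeDl.
(* A part of mass zero would give [n1 <= n2] on all measurable sets; for probabilities, passing to
   complements turns this into equality. *)
have pos (n1 n2 : probability X R) (s : {finite_measure set X -> \bar R}) :
    n1 A0 != n2 A0 -> (forall A, measurable A -> n1 A <= n2 A + s A) ->
    0 < s [set: X].
  move=> n12 le12; rewrite lt_neqAle measure_ge0 andbT; apply/negP => /eqP sT.
  have le A : measurable A -> n1 A <= n2 A.
    move=> mA; have := le12 _ mA.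
    rewrite (_ : s A = 0) ?adde0//; apply/eqP; rewrite eq_le measure_ge0 andbT sT.
    by apply: le_measure; rewrite ?inE.
  have f1 : n1 A0 \is a fin_num := fin_num_measure n1 A0 mA0.
  have f2 : n2 A0 \is a fin_num := fin_num_measure n2 A0 mA0.
  move/eqP: n12; apply; apply/eqP; rewrite eq_le le//=.
  have := le _ (measurableC mA0); rewrite !probability_setC//.
  by rewrite leeD2lE// leeN2.
exists s1, s2, P; split; [|split; [|split]].
- split => //.
    exact: (excessive_positive_part mP st1 st2 le1 eq1).
  exact: (excessive_positive_part mN st2 st1 le2 eq2).
- split.
  + by rewrite s1E ?setICl ?measure0 ?sube0//; exact: measurableC.
  + by rewrite s2E// NE setICr !measure0 sube0.
  + exact: pos le1.
  + by apply: pos le2; rewrite eq_sym.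
- move=> A mA; apply: (@le_trans _ _ (nu1 (A `&` P))).
    by rewrite -eq1// leeDr.
  by apply: le_measure; rewrite ?inE//; exact: measurableI.
- move=> A mA; apply: (@le_trans _ _ (nu2 (A `&` N))).
    by rewrite -eq2// leeDr.
  by apply: le_measure; rewrite ?inE//; exact: measurableI.
Qed.

End singular_parts.

(** * Borel sets of the unit interval and of its continuous self-maps *)

Section borel_continuous.
Variables (R : realType) (T : ptopologicalType).

Lemma borel_open (U : set T) : open U -> measurable (U : set (borel T)).
Proof. exact: sub_sigma_algebra. Qed.

Lemma borel_closed (U : set T) : closed U -> measurable (U : set (borel T)).
Proof. by move=> cU; rewrite -[U]setCK; apply: measurableC; apply: borel_open; exact: closed_openC. Qed.

Lemma continuous_borel (f : T -> R) : continuous f ->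
  measurable_fun [set: borel T] (f : borel T -> R).
Proof.
move=> /continuousP cf; apply: (measurability _ (RGenOpens.measurableE R)).
move=> _ [_ [a [b ->] <-]]; rewrite setTI; apply: borel_open; apply: cf.
exact: interval_open.
Qed.

End borel_continuous.

Section unit_interval_borel.
Variable R : realType.
Local Notation X := (borel (I01 R)).
Local Notation C := (borel (C01 R)).

Lemma nbhs_I01P (x : I01 R) (P : set (I01 R)) : nbhs x P <->
  exists2 e : R, 0 < e & forall y, `|I01_val x - I01_val y| < e -> P y.
Proof. by rewrite -nbhs_ballE; split=> -[e e0 H]; exists e. Qed.

Lemma open_I01P (U : set (I01 R)) : open U <-> forall x, U x ->
  exists2 e : R, 0 < e & forall y, `|I01_val x - I01_val y| < e -> U y.
Proof.
rewrite openE; split=> [oU x /oU /nbhs_I01P //|H x Ux].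
by apply/nbhs_I01P; exact: H.
Qed.

Lemma I01_val_continuous : continuous (@I01_val R).
Proof. by move=> x; exact: initial_continuous. Qed.

Lemma measurable_I01_val : measurable_fun [set: X] (@I01_val R : X -> R).
Proof. by apply: continuous_borel; exact: I01_val_continuous. Qed.

Lemma measurable_to_I01 d (Y : measurableType d) (f : Y -> X) :
  measurable_fun [set: Y] (fun y => I01_val (f y)) -> measurable_fun [set: Y] f.
Proof.
move=> mf; apply: (@measurability _ _ _ _ _ f (@open (I01 R))) => //.
move=> _ [U [V oV <-] <-]; rewrite setTI -comp_preimage.
rewrite -[X in measurable X]setTI; apply: mf => //.
exact: open_measurable.
Qed.

Lemma clamp01_subproof (r : R) : Num.max 0 (Num.min 1 r) \in `[0 : R, 1]%classic.
Proof. by rewrite inE /= in_itv /= le_max lexx ge_max ler01 ge_min lexx. Qed.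

(** A retraction of the whole line onto the interval, so that real expressions yield points of [I01]
    without a membership proof. *)
Definition clamp01 (r : R) : I01 R := exist _ (Num.max 0 (Num.min 1 r)) (clamp01_subproof r).

Lemma clamp01_val r : 0 <= r <= 1 -> I01_val (clamp01 r) = r.
Proof. by move=> /andP[r0 r1]; rewrite /I01_val /= (min_idPr r1) (max_idPr r0). Qed.

Lemma clamp01K x : clamp01 (I01_val x) = x.
Proof. by apply: I01_val_inj; rewrite clamp01_val// I01_valP. Qed.

Lemma measurable_clamp01 : measurable_fun [set: R] (clamp01 : R -> X).
Proof.
apply: measurable_to_I01; apply: measurable_maxr => //.
exact: measurable_minr.
Qed.

Lemma C01_continuity (f : C01 R) (x : I01 R) (e : R) : 0 < e ->
  exists2 d : R, 0 < d & forall y,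
    `|I01_val x - I01_val y| < d -> `|I01_val (f x) - I01_val (f y)| < e.
Proof.
move=> e0.
have /nbhs_I01P[d d0 H] : nbhs x (f @^-1` (ball (f x) e)).
  by apply: (@cts_fun _ _ f); exact: nbhsx_ballx.
by exists d.
Qed.

Lemma C01_eval_continuous (x : I01 R) : continuous (fun f : C01 R => I01_val (f x)).
Proof.
move=> f; apply/(@cvgrPdist_lt _ _ _ (nbhs f) (nbhs_filter f)) => e e0; apply/nbhs_ballP; exists e => //= g fg.
by apply: le_lt_trans fg; exact: C01_dist_ub.
Qed.

Definition grid (m : nat) (x : R) : R :=
  (Num.truncn (m.+1%:R * x))%:R / m.+1%:R.

Lemma grid_le m x : 0 <= x -> grid m x <= x.
Proof.
move=> x0; by rewrite /grid ler_pdivrMr// mulrC truncn_le mulr_ge0.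
Qed.

Lemma grid_gt m x : x - m.+1%:R^-1 < grid m x.
Proof.
rewrite ltrBlDr /grid -[X in _ + X]mul1r -mulrDl ltr_pdivlMr// mulrC natr1.
exact: truncnS_gt.
Qed.

Lemma grid_itv m x : 0 <= x <= 1 -> 0 <= grid m x <= 1.
Proof.
move=> /andP[x0 x1]; rewrite (le_trans (grid_le m x0))// andbT.
by rewrite /grid divr_ge0.
Qed.

Lemma grid_dist m x : 0 <= x -> `|x - grid m x| <= m.+1%:R^-1.
Proof.
move=> x0; rewrite ger0_norm ?subr_ge0 ?grid_le// lerBlDr -lerBlDl.
exact/ltW/grid_gt.
Qed.

Lemma cvg_grid (f : I01 R -> I01 R) x : continuous f ->
  I01_val (f (clamp01 (grid m (I01_val x)))) @[m --> \oo] --> I01_val (f x).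
Proof.
move=> cf; apply/cvgrPdist_lt => e e0.
have /nbhs_I01P[d d0 H] : nbhs x (f @^-1` (ball (f x) e)).
  by apply: (cf x); exact: nbhsx_ballx.
have /andP[x0 x1] := I01_valP x.
near=> m; apply: H.
rewrite clamp01_val ?grid_itv ?I01_valP//.
apply: le_lt_trans (grid_dist m x0) _.
by near: m; exact: near_infty_natSinv_lt (PosNum d0).
Unshelve. all: by end_near.
Qed.

Definition eval01 (p : C * X) : X := (p.1 : C01 R) p.2.

(** Measurability is for the product sigma-algebra, so continuity of evaluation does not give it
    directly. Rounding [x] down to a grid makes the value a finite sum of products of an indicator
    in [x] and an evaluation at a fixed point, and these sums converge because each map is
    continuous. *)
Lemma measurable_eval01 : measurable_fun [set: C * X] eval01.
Proof.
apply: measurable_to_I01.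
pose h m (p : C * X) : R := I01_val ((p.1 : C01 R) (clamp01 (grid m (I01_val p.2)))).
apply: (@measurable_fun_cvg _ _ _ _ h) => [m|p _]; last first.
  by apply: cvg_grid; exact: cts_fun.
pose k (p : C * X) : nat := Num.truncn (m.+1%:R * I01_val p.2).
(* There are [m.+2] cells, since [x = 1] is rounded to the index [m.+1]. *)
have -> : h m = fun p => \sum_(j < m.+2)
    \1_[set x : X | Num.truncn (m.+1%:R * I01_val x) = j] p.2 *
    I01_val ((p.1 : C01 R) (clamp01 (j%:R / m.+1%:R))).
  apply/funext => p; rewrite /h /grid.
  have km : (k p < m.+2)%N.
    have /andP[p0 p1] := I01_valP p.2.
    rewrite ltnS /k -(ler_nat R); apply: (@le_trans _ _ (m.+1%:R * I01_val p.2)).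
      by rewrite truncn_le mulr_ge0.
    by rewrite ler_piMr//; case/andP: (I01_valP p.2).
  rewrite (bigD1 (Ordinal km))//= indicE mem_set// mul1r big1 ?addr0// => j jk.
  rewrite indicE memNset ?mul0r//= => e; move/eqP: jk; apply; apply: val_inj.
  by rewrite /= -e.
apply: measurable_sum => j; apply: measurable_funM.
  apply: measurableT_comp; last exact: measurable_snd.
  apply: measurable_indic.
  have -> : [set x : X | Num.truncn (m.+1%:R * I01_val x) = j] =
      (@I01_val R) @^-1` `[j%:R / m.+1%:R, j.+1%:R / m.+1%:R[.
    apply/seteqP; split=> x /=; rewrite in_itv/= ler_pdivrMr// ltr_pdivlMr//;
      rewrite (mulrC (I01_val x)).
      move=> <-; rewrite truncn_itv// mulr_ge0//.
      by case/andP: (I01_valP x).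
    by move=> /truncn_def.
  by rewrite -[X in measurable X]setTI; apply: measurable_I01_val.
have mg : measurable_fun [set: C]
    (fun g : C => I01_val ((g : C01 R) (clamp01 (j%:R / m.+1%:R)))).
  by apply: continuous_borel; exact: C01_eval_continuous.
exact: (measurableT_comp mg measurable_fst).
Qed.

Lemma supp_closed (mu : probability C R) : closed (supp mu : set (C01 R)).
Proof.
rewrite -openC; have -> : ~` (supp mu : set (C01 R)) =
    \bigcup_(U in [set U : set (C01 R) | open U /\ mu U = 0%E]) U.
  apply/seteqP; split=> g /=.
    rewrite /supp /= -existsNP => -[U /not_implyP[[oU Ug]]] /negP.
    by rewrite lt_neqAle measure_ge0 andbT negbK => /eqP U0; exists U.
  by move=> [U [oU U0] Ug] /(_ U (conj oU Ug)); rewrite U0 ltxx.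
by apply: bigcup_open => U [].
Qed.

Lemma measurable_supp (mu : probability C R) : measurable (supp mu : set C).
Proof. by apply: borel_closed; exact: supp_closed. Qed.

Definition apart_by (C D : set (I01 R)) (d : R) :=
  forall x y, C x -> D y -> d <= `|I01_val x - I01_val y|.

(** Inner approximation of [A] and of its complement at once, by sets a positive distance apart. The
    symmetry gives stability under complements, so that the class of such sets is a
    sigma-algebra. *)
Definition inner_separable (nu : set X -> \bar R) (A : set X) :=
  forall e : R, 0 < e -> exists (C D : set X) (d : R),
    [/\ measurable C, measurable D, C `<=` A & D `<=` ~` A] /\
    [/\ 0 < d, apart_by C D d & (nu (~` (C `|` D)) < e%:E)%E].

Lemma inner_separableC nu A : inner_separable nu A -> inner_separable nu (~` A).
Proof.
move=> sA e e0; have [C [D [d [[mC mD CA DA] [d0 sep nuCD]]]]] := sA e e0.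
exists D, C, d; split; split => //; first by rewrite setCK.
  by move=> x y Dx Cy; rewrite distrC; exact: sep.
by rewrite setUC.
Qed.

Lemma apart_by_bigcup (C D : nat -> set (I01 R)) (d : nat -> R) N :
  (forall n, 0 < d n) -> (forall n, apart_by (C n) (D n) (d n)) ->
  exists2 e, 0 < e & apart_by (\big[setU/set0]_(n < N) C n) (\bigcap_n D n) e.
Proof.
move=> d0 sep; elim: N => [|N [e e0 IH]].
  by exists 1 => // x y; rewrite big_ord0.
exists (Num.min e (d N)); first by rewrite lt_min e0 d0.
move=> x y; rewrite big_ord_recr/= => -[Cx|Cx] Dy; rewrite ge_min.
  by rewrite IH.
by apply/orP; right; apply: (sep N) => //; exact: Dy.
Qed.

Lemma ereal_cvg_lt (u : (\bar R)^nat) (l e : \bar R) :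
  u @ \oo --> l -> (l < e)%E -> exists N, (u N < e)%E.
Proof.
move=> ul le; apply: contrapT => nN; move: le; apply/negP; rewrite -leNgt.
rewrite -(cvg_lim _ ul)//; apply: lime_ge; first by apply/cvg_ex; exists l.
by apply: nearW => N; rewrite leNgt; apply/negP => uN; apply: nN; exists N.
Qed.

(** The distances [d n] may tend to 0, so only finitely many [C n] are kept, against the
    intersection of all [D n]. Keeping enough of them costs little mass, by continuity from
    above. *)
Lemma inner_separable_bigcup (nu : {finite_measure set X -> \bar R})
    (A : nat -> set X) :
  (forall n, inner_separable nu (A n)) -> inner_separable nu (\bigcup_n A n).
Proof.
move=> sA e e0.
have e20 : 0 < e / 2 by rewrite divr_gt0.
have en n : 0 < (e / 2) / (2 ^ n.+1)%:R by rewrite divr_gt0// ltr0n expn_gt0.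
have /choice[C /choice[D /choice[d H]]] n := sA n _ (en n).
have mC n : measurable (C n) by have [[]] := H n.
have mD n : measurable (D n) by have [[]] := H n.
have CA n : C n `<=` A n by have [[]] := H n.
have DA n : D n `<=` ~` A n by have [[]] := H n.
have d0 n : 0 < d n by have [_ []] := H n.
have sep n : apart_by (C n) (D n) (d n) by have [_ []] := H n.
have nuCD n : (nu (~` (C n `|` D n)) < ((e / 2) / (2 ^ n.+1)%:R)%:E)%E.
  by have [_ []] := H n.
pose DD : set X := \bigcap_n D n.
have mDD : measurable DD by apply: bigcap_measurable => // n _.
pose CN N : set X := \big[setU/set0]_(n < N) C n.
have mCN N : measurable (CN N) by apply: bigsetU_measurable.
pose E N : set X := ~` (CN N `|` DD).
have mE N : measurable (E N) by apply/measurableC/measurableU.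
have mEE : measurable (\bigcap_N E N) by apply: bigcap_measurable => // n _.
have cvg : nu (E N) @[N --> \oo] --> nu (\bigcap_N E N).
  apply: nonincreasing_cvg_mu => //.
    by rewrite -ge0_fin_numE ?measure_ge0//; exact: fin_num_measure.
  move=> m n mn; apply/subsetPset; apply: subsetC; apply: setSU.
  move=> x; rewrite /CN -!bigcup_mkord => -[i /= im Cx]; exists i => //=.
  exact: leq_trans mn.
have small : (nu (\bigcap_N E N) < e%:E)%E.
  apply: (@le_lt_trans _ _ (e / 2)%:E); last by rewrite lte_fin ltr_pdivrMr// ltr_pMr// ltr1n.
  (* A point missed at every finite stage avoids some [C n] and [D n] together: lying in no [C n],
     it would otherwise be in all [D n], hence in [DD]. *)
  apply: (@le_trans _ _ (\sum_(n <oo) nu (~` (C n `|` D n)))%E).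
    apply: measure_sigma_subadditive => //.
      by move=> n; apply/measurableC/measurableU.
    move=> x Ex; apply: contrapT => nx.
    have CDx n : C n x \/ D n x.
      by apply: contrapT => nCD; apply: nx; exists n.
    have nC n : ~ C n x.
      move=> Cx; apply: (Ex n.+1 Logic.I); left.
      by rewrite /CN big_ord_recr/=; right.
    apply: (Ex 0%N Logic.I); right => n _.
    by have [/nC|] := CDx n.
  apply: (@le_trans _ _ (\sum_(n <oo) ((e / 2) / (2 ^ n.+1)%:R)%:E)%E).
    by apply: lee_nneseries => n _; rewrite ?measure_ge0// ltW.
  exact: (epsilon_trick0 xpredT (ltW e20)).
have [N EN] := ereal_cvg_lt cvg small.
have [r r0 sepr] := @apart_by_bigcup C D d N d0 sep.
exists (CN N), DD, r; split; split => //.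
- move=> x; rewrite /CN -bigcup_mkord => -[n _ Cx]; exists n => //; exact: CA.
- by move=> x DDx [n _ Ax]; apply: (DA n x) => //; exact: DDx.
Qed.

Lemma inner_separable_open (nu : {finite_measure set X -> \bar R}) (A : set (I01 R)) :
  open A -> inner_separable nu A.
Proof.
move=> oA e e0.
pose C k : set X := [set x : I01 R | forall y, ~ A y -> k.+1%:R^-1 <= `|I01_val x - I01_val y|].
have mC k : measurable (C k).
  rewrite -[C k]setCK; apply: measurableC; apply: borel_open; apply/open_I01P => x.
  rewrite /C /= -existsNP => -[y /not_implyP[nAy /negP]]; rewrite -ltNge => xy.
  exists (k.+1%:R^-1 - `|I01_val x - I01_val y|); first by rewrite subr_gt0.
  move=> z; rewrite ltrBrDr => xz /(_ y nAy); apply/negP; rewrite -ltNge.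
  apply: le_lt_trans (ler_distD (I01_val x) _ _) _.
  by rewrite (distrC (I01_val z)).
have mA : measurable (A : set X) := borel_open oA.
pose E k : set X := ~` (C k `|` ~` A).
have mE k : measurable (E k) by apply/measurableC/measurableU => //; exact: measurableC.
have E0 : \bigcap_k E k = set0.
  apply/seteqP; split=> // x Ex.
  have Ax : A x by apply: contrapT => nAx; apply: (Ex 0%N Logic.I); right.
  have /open_I01P/(_ x Ax)[r r0 rA] := oA.
  have [k kr] : exists k, k.+1%:R^-1 < r.
    by have [k _ /(_ k (leqnn k))] := near_infty_natSinv_lt (PosNum r0); exists k.
  apply: (Ex k Logic.I); left => y nAy; rewrite leNgt; apply/negP => xy.
  by apply: nAy; apply: rA; exact: lt_trans kr.
have cvg : nu (E k) @[k --> \oo] --> nu (\bigcap_k E k).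
  apply: nonincreasing_cvg_mu => //.
  - by rewrite -ge0_fin_numE ?measure_ge0//; exact: fin_num_measure.
  - by apply: bigcap_measurable => // k _.
  move=> m n mn; apply/subsetPset; apply: subsetC; apply: setSU => x Cx y nAy.
  by apply: le_trans (Cx y nAy); rewrite lef_pV2 ?posrE// ler_nat.
rewrite E0 measure0 in cvg.
have [k Ek] : exists k, (nu (E k) < e%:E)%E.
  by apply: (ereal_cvg_lt cvg); rewrite lte_fin.
exists (C k), (~` A), k.+1%:R^-1; split; split => //.
- exact: measurableC.
- move=> x Cx; apply: contrapT => nAx; have := Cx x nAx.
  by rewrite subrr normr0 leNgt invr_gt0 ltr0n.
- by move=> x y Cx; exact: Cx.
Qed.

Lemma borel_inner_separable (nu : {finite_measure set X -> \bar R}) (A : set X) :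
  measurable A -> inner_separable nu A.
Proof.
apply: (@smallest_sub _ (sigma_algebra setT) open (inner_separable nu)).
  split.
  - by apply: inner_separable_open; exact: open0.
  - by move=> B sB; rewrite setTD; exact: inner_separableC.
  - exact: inner_separable_bigcup.
by move=> B; exact: inner_separable_open.
Qed.

End unit_interval_borel.

(** * Excessive measures near an endpoint *)

Section mass_near_endpoint.
Variable R : realType.
Local Notation X := (borel (I01 R)).
Local Notation C := (borel (C01 R)).
(* [r] is the distance to the endpoint where the mass accumulates: to 0
   under (U1), to 1 under (U2). *)
Variables (mu : probability C R) (r : I01 R -> R).
Hypothesis r_isom : forall x y, `|r x - r y| = `|I01_val x - I01_val y|.
Hypothesis r_itv : forall x, 0 <= r x <= 1.
Hypothesis r_surj : forall s : R, 0 <= s <= 1 -> exists x, r x = s.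
Hypothesis r_move : forall x, 0 < r x < 1 ->
  exists2 g : C01 R, supp mu g & r (g x) < r x.

Lemma open_r_lt s : open [set x : I01 R | r x < s].
Proof.
apply/open_I01P => x /= xs; exists (s - r x); first by rewrite subr_gt0.
move=> y; rewrite -r_isom distrC => /(le_lt_trans (ler_norm _)).
by rewrite ltrBlDr subrK.
Qed.

Lemma open_r_gt s : open [set x : I01 R | s < r x].
Proof.
apply/open_I01P => x /= xs; exists (r x - s); first by rewrite subr_gt0.
move=> y; rewrite -r_isom => /(le_lt_trans (ler_norm _)).
by rewrite ltrBlDr -ltrBlDl opprB addrC subrK.
Qed.

Lemma measurable_r_lt s : measurable ([set x | r x < s] : set X).
Proof. by apply: borel_open; exact: open_r_lt. Qed.

Lemma measurable_r_gt s : measurable ([set x | s < r x] : set X).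
Proof. by apply: borel_open; exact: open_r_gt. Qed.

Lemma measurable_r_ge s : measurable ([set x | s <= r x] : set X).
Proof.
rewrite (_ : [set x | s <= r x] = ~` [set x | r x < s]).
  by apply: measurableC; exact: measurable_r_lt.
by apply/seteqP; split=> x /=; rewrite leNgt => /negP.
Qed.

Lemma measurable_r_eq s : measurable ([set x | r x = s] : set X).
Proof.
rewrite (_ : [set x | r x = s] = ~` [set x | r x < s] `&` ~` [set x | s < r x]).
  apply: measurableI; apply: measurableC; first exact: measurable_r_lt.
  exact: measurable_r_gt.
apply/seteqP; split=> x /=; first by move=> ->; rewrite ltxx.
by move=> [/negP + /negP]; rewrite -!leNgt => a b; apply/eqP; rewrite eq_le a b.
Qed.

Variable lam : {finite_measure set X -> \bar R}.
Hypothesis lam_exc : excessive mu (@eval01 R) lam.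
Hypothesis lam_gt0 : (0 < lam [set: X])%E.
Hypothesis lam_r0 : lam [set x | r x = 0] = 0%E.
Hypothesis lam_r1 : lam [set x | r x = 1] = 0%E.

(** Otherwise the lowest level [s] of [r] charged by [lam] lies strictly between 0 and 1. Some [g0]
    in the support moves the point at level [s] strictly lower, and by continuity so do all maps
    near [g0] for all nearby points. These carry positive mass, which excessiveness forces onto the
    null set of levels below [s]. *)
Lemma excessive_mass_near_endpoint (eta : R) :
  0 < eta -> (0 < lam [set x : X | (0 < r x < eta)%R])%E.
Proof.
move=> eta0; rewrite lt_neqAle measure_ge0 andbT; apply/negP => /eqP le0.
pose L s : set X := [set x | r x < s].
have mL s : measurable (L s) := measurable_r_lt s.
have L_mono s t : s <= t -> (lam (L s) <= lam (L t))%E.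
  by move=> st; apply: le_measure; rewrite ?inE// => x /= xs; exact: lt_le_trans st.
have Leta : lam (L eta) = 0%E.
  apply/eqP; rewrite eq_le measure_ge0 andbT.
  apply: (@le_trans _ _ (lam ([set x | r x = 0] `|` [set x : X | 0 < r x < eta]))).
    have m2 : measurable [set x : X | 0 < r x < eta].
      rewrite (_ : [set x : X | _] = [set x | 0 < r x] `&` L eta).
        by apply: measurableI => //; exact: measurable_r_gt.
      by apply/seteqP; split=> x /=; [move/andP|case=> -> ->].
    apply: le_measure; rewrite ?inE//.
      by apply: measurableU => //; exact: measurable_r_eq.
    move=> x /= xe; have /andP[+ _] := r_itv x.
    by rewrite le_eqVlt => /orP[/eqP <-|x0]; [left|right; rewrite x0].
  apply: le_trans (measureU2 _ _ _) _; first exact: measurable_r_eq.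
    rewrite (_ : [set x : X | _] = [set x | 0 < r x] `&` L eta).
      by apply: measurableI => //; exact: measurable_r_gt.
    by apply/seteqP; split=> x /=; [move/andP|case=> -> ->].
  by rewrite [X in (X + _)%E]lam_r0 add0e le0.
pose S := [set s : R | (0 < lam (L s))%E].
have S_lb : lbound S eta.
  move=> s; rewrite /S /= leNgt => sS; apply/negP => /ltW /L_mono.
  by rewrite Leta leNgt sS.
have S2 : S 2.
  rewrite /S /= (_ : L 2 = setT)//; apply/seteqP; split=> // x _.
  rewrite /L /=; apply: (@le_lt_trans _ _ 1); first by have /andP[] := r_itv x.
  by rewrite ltr1n.
have S_inf : has_inf S by split; [exists 2|exists eta].
pose s := inf S.
have s0 : 0 < s.
  by apply: (lt_le_trans eta0); apply: lb_le_inf => //; exists 2.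
have Lt0 t : t < s -> lam (L t) = 0%E.
  move=> ts; apply/eqP; rewrite eq_le measure_ge0 andbT leNgt; apply/negP => St.
  have : s <= t by apply: ge_inf => //; exists eta.
  by rewrite leNgt ts.
have Ls0 : lam (L s) = 0%E.
  pose F n := L (s - n.+1%:R^-1).
  have <- : \bigcup_n F n = L s.
    apply/seteqP; split=> x /=.
      move=> [n _]; rewrite /F /L /= => /lt_trans; apply.
      by rewrite ltrBlDr ltrDl invr_gt0.
    move=> xs; have sx : 0 < s - r x by rewrite subr_gt0.
    have [n _ /(_ n (leqnn n)) /= nx] := near_infty_natSinv_lt (PosNum sx).
    by exists n => //; rewrite /F /L /= ltrBrDl -ltrBrDr.
  have c : lam (F n) @[n --> \oo] --> lam (\bigcup_n F n).
    apply: nondecreasing_cvg_mu.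
    - by move=> n; exact: mL.
    - by apply: bigcup_measurable => n _; exact: mL.
    move=> m n mn; apply/subsetPset => x; rewrite /F /L /= => /lt_le_trans; apply.
    by rewrite lerD2l lerN2 lef_pV2 ?posrE// ler_nat.
  rewrite -(cvg_lim _ c)// (_ : (fun n => _) = cst 0%E) ?lim_cst//.
  by apply/funext => n; rewrite Lt0// ltrBlDr ltrDl invr_gt0.
have s1 : s < 1.
  rewrite ltNge; apply/negP => s1.
  move: lam_gt0; apply/negP; rewrite -leNgt.
  apply: (@le_trans _ _ (lam (L s `|` [set x | r x = 1]))).
    apply: le_measure; rewrite ?inE//.
      by apply: measurableU => //; exact: measurable_r_eq.
    move=> x _; have /andP[_] := r_itv x.
    rewrite le_eqVlt => /orP[/eqP ?|x1]; [by right|left].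
    exact: lt_le_trans s1.
  apply: le_trans (measureU2 _ _ _) _ => //; first exact: measurable_r_eq.
  by rewrite [X in (X + _)%E]Ls0 [X in (_ + X)%E]lam_r1 adde0.
have [x xs] : exists x, r x = s by apply: r_surj; rewrite !ltW.
have [g0 g0supp g0x] : exists2 g : C01 R, supp mu g & r (g x) < r x.
  by apply: r_move; rewrite xs s0.
(* Half of the gain in level is spent on replacing [g0] by a nearby map, half on replacing [x] by a
   nearby point. *)
pose c := (s - r (g0 x)) / 2.
have c0 : 0 < c by rewrite divr_gt0// subr_gt0 -xs.
have [d d0 g0d] := C01_continuity g0 x c0.
pose U : set (C01 R) := (ball g0 c)°.
have U0 : (0 < mu (U : set C))%E.
  by apply: g0supp; exact: (open_nbhs_ball g0 (PosNum c0)).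
pose O : set X := [set y | s <= r y < s + d].
have mO : measurable O.
  rewrite (_ : O = [set x | s <= r x] `&` L (s + d)).
    by apply: measurableI => //; exact: measurable_r_ge.
  apply/seteqP; split=> y /=; first by move/andP.
  by move=> [? ?]; apply/andP.
have O0 : (0 < lam O)%E.
  have [t St ts] : exists2 t, S t & t < s + d.
    by apply: inf_adherent.
  apply: (lt_le_trans (St : (0 < lam (L t))%E)).
  apply: (@le_trans _ _ (lam (L s `|` O))).
    apply: le_measure; rewrite ?inE//; first exact: measurableU.
    move=> y /= yt; have [ys|sy] := ltP (r y) s; [by left|right].
    by rewrite /O /= sy/=; exact: lt_trans ts.
  by apply: le_trans (measureU2 _ _ _) _ => //; rewrite [X in (X + _)%E]Ls0 add0e.
have mU : measurable (U : set C) by apply: borel_open; exact: open_interior.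
suff : (0 < lam (L s))%E by rewrite Ls0 ltxx.
apply: lt_le_trans (lam_exc (mL s)).
apply: (@lt_le_trans _ _ ((mu \x lam)%E ((U : set C) `*` O))).
  by rewrite product_measure1E// mule_gt0.
apply: le_measure; rewrite ?inE//.
- exact: measurableX.
- exact: (measurable_preimage_ev (@measurable_eval01 R)).
move=> [g y] /= [Ug /andP[sy ysd]].
have gd : C01_dist g0 g < c by have := interior_subset Ug.
have xy : `|I01_val x - I01_val y| < d.
  by rewrite -r_isom xs distrC ger0_norm ?subr_ge0// ltrBlDl.
rewrite /L /eval01 /=.
have d1 : r (g y) - r (g0 x) < c + c.
  apply: (le_lt_trans (ler_norm _)).
  apply: (le_lt_trans (ler_distD (r (g0 y)) _ _)); apply: ltrD.
    by rewrite r_isom distrC; apply: le_lt_trans (C01_dist_ub _ _ _) gd.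
  by rewrite distrC r_isom; exact: g0d.
have cc : c + c = s - r (g0 x) by rewrite -splitr.
by move: d1; rewrite cc ltrBlDr subrK.
Qed.

End mass_near_endpoint.

Lemma alternating_points (T : Type) (R : realType) (r : T -> R) (P Q : set T) :
  (forall e : R, 0 < e -> exists2 x, P x & 0 < r x < e) ->
  (forall e : R, 0 < e -> exists2 x, Q x & 0 < r x < e) ->
  exists x y : nat -> T, [/\ forall i, P (x i), forall i, Q (y i),
    forall i, r (y i) < r (x i) & forall i, r (x i.+1) < r (y i)].
Proof.
move=> hP hQ; have [t0 _ _] := hP 1 ltr01.
have ch (A : set T) : (forall e : R, 0 < e -> exists2 x, A x & 0 < r x < e) ->
    exists f : R -> T, forall e : R, 0 < e -> A (f e) /\ 0 < r (f e) < e.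
  move=> hA; have /choice[f fP] : forall e : R, exists y, 0 < e -> A y /\ 0 < r y < e.
    move=> e; have [e0|e0] := ltP 0 e; last by exists t0.
    by have [x Ax xe] := hA e e0; exists x.
  by exists f.
have [f fP] := ch _ hP; have [h hQ'] := ch _ hQ.
pose x := fix x n := if n is m.+1 then f (r (h (r (x m)))) else f 1.
have x0 n : 0 < r (x n) /\ P (x n).
  elim: n => [|n [xn0 _]] /=; first by have [? /andP[]] := fP 1 ltr01.
  have [_ /andP[h0 _]] := hQ' _ xn0.
  by have [? /andP[]] := fP _ h0.
exists x, (fun n => h (r (x n))); split=> n.
- by case: (x0 n).
- by case: (x0 n) => xn0 _; case: (hQ' _ xn0).
- by case: (x0 n) => xn0 _; case: (hQ' _ xn0) => _ /andP[].
- have [xn0 _] := x0 n; have [_ /andP[h0 _]] := hQ' _ xn0.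
  by have [_ /andP[]] := fP _ h0.
Qed.

(** * Variation along uniform grids *)

Section alternating_sums.
Variables (R : realDomainType) (u : nat -> R).

Lemma ler_dist_telescope a b : (a <= b)%N ->
  `|u b - u a| <= \sum_(a <= j < b) `|u j.+1 - u j|.
Proof. by move=> ab; rewrite -telescope_sumr//; exact: ler_norm_sum. Qed.

Lemma alternating_sum_incr (k l : nat -> nat) M :
  (forall i, (k i <= l i <= k i.+1)%N) ->
  \sum_(0 <= i < M) `|u (k i) - u (l i)| <=
  \sum_(k 0%N <= j < k M) `|u j.+1 - u j|.
Proof.
move=> kl; elim: M => [|M IH]; first by rewrite !big_geq.
have k0M : (k 0 <= k M)%N.
  elim: M {IH} => // M IH; apply: (leq_trans IH).
  by have /andP[kl1 lk] := kl M; exact: leq_trans lk.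
have /andP[kl1 lk] := kl M.
rewrite big_nat_recr//= (big_cat_nat k0M (leq_trans kl1 lk))/=.
apply: lerD IH _; rewrite (big_cat_nat kl1 lk)/= distrC.
apply: le_trans (ler_dist_telescope kl1) _; rewrite lerDl.
by apply: sumr_ge0.
Qed.

Lemma alternating_sum_decr (k l : nat -> nat) M :
  (forall i, (k i.+1 <= l i <= k i)%N) ->
  \sum_(0 <= i < M) `|u (k i) - u (l i)| <=
  \sum_(k M <= j < k 0%N) `|u j.+1 - u j|.
Proof.
move=> kl; elim: M => [|M IH]; first by rewrite !big_geq.
have kM0 : (k M <= k 0)%N.
  elim: M {IH} => // M IH; apply: leq_trans IH.
  by have /andP[kl1 lk] := kl M; exact: leq_trans lk.
have /andP[kl1 lk] := kl M.
rewrite big_nat_recr//= (big_cat_nat (leq_trans kl1 lk) kM0)/=.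
rewrite addrC; apply: lerD _ IH; rewrite (big_cat_nat kl1 lk)/=.
apply: le_trans (ler_dist_telescope lk) _; rewrite lerDr.
by apply: sumr_ge0.
Qed.

End alternating_sums.

Section grid_variation.
Variable R : realType.
Implicit Types f : I01 R -> I01 R.

Definition grid_point (m j : nat) : I01 R := clamp01 (j%:R / m.+1%:R).

Lemma grid_point_val m j : (j <= m.+1)%N ->
  I01_val (grid_point m j) = j%:R / m.+1%:R.
Proof.
by move=> jm; rewrite clamp01_val// divr_ge0//= ler_pdivrMr// mul1r ler_nat.
Qed.

(** Finitely many evaluations, hence measurable in a random [f]. For continuous [f] a bound for all
    [m] amounts to a bound on the total variation, by [grid_variation_le] and [I01_variation_le]. *)
Definition grid_variation f m : R := \sum_(0 <= j < m.+1)
  `|I01_val (f (grid_point m j.+1)) - I01_val (f (grid_point m j))|.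

Lemma grid_variation_id m : grid_variation idfun m = 1.
Proof.
rewrite /grid_variation (eq_big_nat _ _ (F2 := fun=> m.+1%:R^-1)) => [|j /andP[_ jm]].
  by rewrite sumr_const_nat subn0 -[LHS]mulr_natr mulVf.
rewrite !grid_point_val//; last exact: ltnW.
by rewrite -mulrBl -natrB// subSnn mul1r ger0_norm.
Qed.

Lemma le_sum_subrange (u : nat -> R) a b n : (b <= n)%N -> (forall j, 0 <= u j) ->
  \sum_(a <= j < b) u j <= \sum_(0 <= j < n) u j.
Proof.
move=> bn u0; have [ab|ba] := leqP a b; last first.
  by rewrite big_geq ?sumr_ge0//; exact: ltnW.
rewrite (@big_cat_nat _ _ _ b 0 n)//= (@big_cat_nat _ _ _ a 0 b)//=.
by rewrite addrAC lerDr addr_ge0// sumr_ge0.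
Qed.

Lemma cvg_sumr {T} {F : set_system T} {FF : Filter F} (v : nat -> T -> R)
    (l : nat -> R) M :
  (forall i, v i m @[m --> F] --> l i) ->
  \sum_(0 <= i < M) v i m @[m --> F] --> \sum_(0 <= i < M) l i.
Proof.
move=> vl; elim: M => [|M IH].
  by under eq_fun do rewrite big_geq//; rewrite big_geq//; exact: cvg_cst.
under eq_fun do rewrite big_nat_recr//=; rewrite big_nat_recr//=.
exact: cvgD.
Qed.

(** Rounding down to the grid preserves the weak order of the chain, so the rounded pairs span
    non-overlapping index ranges of the grid sum; continuity lets the mesh tend to 0. Weak
    inequalities are used because rounding may merge points. *)
Lemma grid_variation_bound f K : continuous f ->
  (forall m, grid_variation f m <= K) ->
  forall (x y : nat -> I01 R) M,
  (forall i, I01_val (x i) <= I01_val (y i) <= I01_val (x i.+1)) \/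
  (forall i, I01_val (x i.+1) <= I01_val (y i) <= I01_val (x i)) ->
  \sum_(0 <= i < M) `|I01_val (f (x i)) - I01_val (f (y i))| <= K.
Proof.
move=> cf fK x y M xy.
pose k m (t : I01 R) : nat := Num.truncn (m.+1%:R * I01_val t).
have k_le m s t : I01_val s <= I01_val t -> (k m s <= k m t)%N.
  by move=> st; apply: le_truncn; rewrite ler_pM2l.
have k_max m t : (k m t <= m.+1)%N.
  have /andP[t0 t1] := I01_valP t.
  rewrite -(ler_nat R); apply: (@le_trans _ _ (m.+1%:R * I01_val t)).
    by rewrite truncn_le mulr_ge0.
  by rewrite ler_piMr.
pose S m := \sum_(0 <= i < M) `|I01_val (f (grid_point m (k m (x i)))) -
   I01_val (f (grid_point m (k m (y i))))|.
have SK m : S m <= K.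
  apply: le_trans (fK m).
  pose u j := I01_val (f (grid_point m j)).
  case: xy => xy.
    apply: le_trans (@alternating_sum_incr _ u (fun i => k m (x i))
      (fun i => k m (y i)) M _) _.
      by move=> i; have /andP[? ?] := xy i; rewrite !k_le.
    exact: le_sum_subrange.
  apply: le_trans (@alternating_sum_decr _ u (fun i => k m (x i))
    (fun i => k m (y i)) M _) _.
    by move=> i; have /andP[? ?] := xy i; rewrite !k_le.
  exact: le_sum_subrange.
have cS : S m @[m --> \oo] -->
    \sum_(0 <= i < M) `|I01_val (f (x i)) - I01_val (f (y i))|.
  apply: cvg_sumr => i; apply: cvg_norm; apply: cvgB; exact: cvg_grid.
rewrite -(cvg_lim _ cS)//; apply: limr_le; first by apply/cvg_ex; eexists; exact: cS.
exact: nearW.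
Qed.

Lemma valL_I01 (h : I01 R -> R) (x : I01 R) :
  valL_ 0 (h : set_type `[0 : R, 1]%classic -> R) (I01_val x) = h x.
Proof. by have := congr1 (fun k => k x) (valLK 0 (h : set_type `[0 : R, 1]%classic -> R)). Qed.

Lemma grid_variation_le f m : ((grid_variation f m)%:E <= I01_variation f)%E.
Proof.
pose s := mkseq (fun j => j.+1%:R / m.+1%:R : R) m.+1.
have nth_s j : (j <= m.+1)%N -> nth 1 (0 :: s) j = I01_val (grid_point m j).
  move=> jm; rewrite grid_point_val//; case: j jm => [|j] jm; first by rewrite mul0r.
  by rewrite /= nth_mkseq.
apply: ereal_sup_ubound; exists (grid_variation f m) => //.
exists s; first split.
- apply/(pathP 1) => j; rewrite size_mkseq => jm.
  rewrite nth_s; last exact: ltnW.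
  rewrite nth_mkseq// grid_point_val; last exact: ltnW.
  by rewrite ltr_pM2r ?invr_gt0// ltr_nat.
- by rewrite (last_nth 1) size_mkseq nth_s// grid_point_val// divff.
rewrite /variation size_mkseq; apply: eq_big_nat => j /andP[_ jm].
have e i : (i <= m.+1)%N ->
    valL_ 0 ((@I01_val R \o f) : set_type `[0 : R, 1]%classic -> R)
    (nth 1 (0 :: s) i) = I01_val (f (grid_point m i)).
  by move=> im; rewrite nth_s// valL_I01.
by rewrite -!e//; exact: ltnW.
Qed.

Lemma I01_variation_le f K : continuous f ->
  (forall m, grid_variation f m <= K) -> (I01_variation f <= K%:E)%E.
Proof.
move=> cf fK; apply: ge_ereal_sup => _ [_ [s ps <-] <-]; rewrite lee_fin.
have [pth /eqP lst] := ps.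
(* The default value 1 keeps the sequence at the right endpoint beyond the partition, so it is
   monotone over all indices. Taking [y i = x i.+1] then recovers the partition sum from
   [grid_variation_bound]. *)
have n01 i : 0 <= nth 1 (0 :: s) i <= 1.
  have [im|im] := ltnP i (size s).+1; last by rewrite nth_default//= ler01 lexx.
  by rewrite (itv_partition_nth_ge im ps) (itv_partition_nth_le im ps).
have nS i : nth 1 (0 :: s) i <= nth 1 (0 :: s) i.+1.
  have [im|im] := ltnP i (size s); first by apply/ltW; exact: (pathP 1 pth).
  by rewrite [leRHS]nth_default//; case/andP: (n01 i).
pose x i : I01 R := clamp01 (nth 1 (0 :: s) i).
have xE i : I01_val (x i) = nth 1 (0 :: s) i by rewrite clamp01_val.
have := @grid_variation_bound f K cf fK x (fun i => x i.+1) (size s).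
rewrite /variation => H; apply: le_trans (H _); last first.
  by left => i; rewrite !xE nS lexx.
rewrite le_eqVlt; apply/orP; left; apply/eqP; apply: eq_bigr => i _.
have e j : valL_ 0 ((@I01_val R \o f) : set_type `[0 : R, 1]%classic -> R)
    (nth 1 (0 :: s) j) = I01_val (f (x j)) by rewrite -xE valL_I01.
by rewrite distrC -!e.
Qed.

End grid_variation.

(** * Random compositions *)

Section product_shift.
Context d (T : measurableType d) (R : realType).
Variables (mu : probability T R) (P : probability (seq_space T) R).
Hypothesis P_product : is_product_measure mu P.

Definition seq_cons (p : T * seq_space T) : seq_space T :=
  fun n => if n is m.+1 then p.2 m else p.1.

Lemma measurable_coordinate n :
  measurable_fun [set: seq_space T] (fun w : seq_space T => w n).
Proof.
move=> _ B mB; rewrite setTI; apply: sub_sigma_algebra.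
by exists n, B.
Qed.

Lemma measurable_seq_cons : measurable_fun [set: T * seq_space T] seq_cons.
Proof.
apply: (@measurability _ _ _ (seq_space T) _ seq_cons (@coordinate_events _ T)) => //.
move=> _ [_ [n [B [mB ->]]] <-]; rewrite setTI.
case: n => [|n]; rewrite -[X in measurable X]setTI.
  exact: (@measurable_fst _ _ T (seq_space T)).
by apply: (measurableT_comp (measurable_coordinate n) (@measurable_snd _ _ T (seq_space T))).
Qed.

Definition rectangle (n : nat) (B : nat -> set T) : set (seq_space T) :=
  [set w | forall i, (i < n)%N -> B i (w i)].

Definition rectangles : set (set (seq_space T)) :=
  [set A | exists n B, (forall i, measurable (B i)) /\ A = rectangle n B].

Lemma measurable_rectangle n B : (forall i, measurable (B i)) ->
  measurable (rectangle n B).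
Proof.
move=> mB; rewrite (_ : rectangle n B =
    \bigcap_(i in [set i | (i < n)%N]) [set w | B i (w i)]).
  apply: bigcap_measurableType => i _.
  rewrite -[X in measurable X]setTI; exact: (measurable_coordinate i).
by [].
Qed.

Lemma rectangles_generate : (@measurable _ (seq_space T)) = <<s rectangles >>.
Proof.
apply/seteqP; split; last first.
  apply: smallest_sub; first exact: sigma_algebra_measurable.
  by move=> _ [n [B [mB ->]]]; exact: measurable_rectangle.
apply: smallest_sub; first exact: smallest_sigma_algebra.
move=> _ [n [B [mB ->]]]; apply: sub_sigma_algebra.
exists n.+1, (fun i => if i == n then B else setT); split.
  by move=> i; case: ifP.
apply/seteqP; split=> w /=.
  by move=> Bw i _; case: eqP => // ->.
by move=> /(_ n (ltnSn n)); rewrite eqxx.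
Qed.

Lemma rectanglesI : setI_closed rectangles.
Proof.
move=> _ _ [n [B [mB ->]]] [m [D [mD ->]]].
exists (maxn n m), (fun i => (if (i < n)%N then B i else setT) `&`
  (if (i < m)%N then D i else setT)); split.
  by move=> i; apply: measurableI; case: ifP.
apply/seteqP; split=> w /=.
  by move=> [Bw Dw] i _; split; case: ifP => // im; [exact: Bw|exact: Dw].
move=> H; split=> i im.
  by have [] := H i (leq_trans im (leq_maxl _ _)); rewrite im.
by have [] := H i (leq_trans im (leq_maxr _ _)); rewrite im.
Qed.

(** Putting an independent map in front turns a rectangle into a product of its first side with a
    shorter rectangle, of the same total mass; rectangles form a generating pi-system. *)
Lemma product_measure_shift A : measurable A ->
  (mu \x P)%E (seq_cons @^-1` A) = P A.
Proof.
move=> mA.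
have -> : (mu \x P)%E (seq_cons @^-1` A) = pushforward (mu \x P)%E seq_cons A by [].
apply/esym; apply: (measure_unique rectangles (fun=> setT)) => //.
- exact: rectangles_generate.
- exact: rectanglesI.
- by exists 0%N, (fun=> setT); split=> //; apply/seteqP; split.
- by rewrite bigcup_const//; exists 0%N.
- exact: measurable_seq_cons.
- move=> mc _ [[|n] [B [mB ->]]].
    have E0 : rectangle 0 B = setT by apply/seteqP; split.
    rewrite E0; transitivity (1%E : \bar R); first exact: probability_setT.
    apply/esym; transitivity ((mu \x P)%E ([set: T] `*` [set: seq_space T])).
      by rewrite setXTT.
    rewrite product_measure1E//=.
    by rewrite [mu _]probability_setT [P _]probability_setT mule1.
  transitivity (\prod_(i < n.+1) mu (B i))%E; first exact: P_product.
  rewrite big_ord_recl; apply/esym.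
  transitivity ((mu \x P)%E (B 0%N `*` rectangle n (fun i => B i.+1))).
    congr ((mu \x P)%E _); apply/seteqP; split=> -[g w] /=.
      by move=> H; split; [exact: (H 0%N)|move=> i im; exact: (H i.+1)].
    by move=> [Bg Bw] [|i]// im; exact: Bw.
  rewrite product_measure1E//; last exact: measurable_rectangle.
  by congr (_ * _)%E; exact: P_product.
- by move=> k; rewrite -ge0_fin_numE ?measure_ge0//; exact: fin_num_measure.
Qed.

End product_shift.

Section random_walk.
Variable R : realType.
Local Notation X := (borel (I01 R)).
Local Notation C := (borel (C01 R)).
Variables (mu : probability C R) (P : probability (seq_space C) R).
Hypothesis P_product : is_product_measure mu P.

Lemma prefix_comp_cons (g : C) (w : seq_space C) n x :
  prefix_comp (seq_cons (g, w) : nat -> C01 R) n.+1 x =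
  (g : C01 R) (prefix_comp (w : nat -> C01 R) n x).
Proof. by elim: n x => [//|n IH] x; exact: IH. Qed.

Lemma prefix_comp_continuous (w : nat -> C01 R) n : continuous (prefix_comp w n).
Proof.
elim: n => [|n IH] x /=; first exact: cvg_id.
by apply: continuous_comp; [exact: cts_fun|exact: IH].
Qed.

Lemma measurable_prefix_comp n : measurable_fun [set: seq_space C * X]
  (fun p : seq_space C * X => prefix_comp (p.1 : nat -> C01 R) n p.2 : X).
Proof.
elim: n => [|n IH] /=; first exact: measurable_snd.
have m1 : measurable_fun [set: seq_space C * X]
    (fun p : seq_space C * X => (p.1, eval01 (p.1 n, p.2))).
  apply: measurable_fun_pair; first exact: measurable_fst.
  apply: (measurableT_comp (@measurable_eval01 R)); apply: measurable_fun_pair.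
    exact: (measurableT_comp (measurable_coordinate n) measurable_fst).
  exact: measurable_snd.
exact: (measurableT_comp IH m1).
Qed.

Lemma measurable_prefix_comp1 n (x : I01 R) : measurable_fun [set: seq_space C]
  (fun w : seq_space C => prefix_comp (w : nat -> C01 R) n x : X).
Proof.
exact: (measurableT_comp (measurable_prefix_comp n) (pair2_measurable (x : X))).
Qed.

(** Integrating out the outermost map [g_1] replaces [f] by its image under [markov_op], evaluated
    at a product of length [n] with the same law as a prefix. This is the only place where products
    and random orbits are compared. *)
Lemma expectation_prefix_comp (f : X -> \bar R) n (x : I01 R) :
  measurable_fun [set: X] f -> (forall y, (0 <= f y)%E) ->
  (\int[P]_w f (prefix_comp (w : nat -> C01 R) n x) =
   iter n (markov_op mu (@eval01 R)) f x)%E.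
Proof.
elim: n f => [|n IH] f mf f0.
  transitivity (\int[P]_w cst (f x) w)%E; first by [].
  by rewrite integral_cst//= [P _]probability_setT mule1.
have mF k : measurable_fun [set: seq_space C]
    (fun w : seq_space C => f (prefix_comp (w : nat -> C01 R) k x)).
  exact: (measurableT_comp mf (measurable_prefix_comp1 k x)).
transitivity (\int[pushforward (mu \x P)%E (@seq_cons _ C)]_w
    f (prefix_comp (w : nat -> C01 R) n.+1 x))%E.
  apply: eq_measure_integral; first exact: measurable_seq_cons.
  by move=> mc A mA _; exact/esym/product_measure_shift.
rewrite ge0_integral_pushforward//; last exact: measurable_seq_cons.
rewrite preimage_setT fubini_tonelli2//; last 2 first.
- by apply: (measurableT_comp (mF n.+1)); exact: measurable_seq_cons.
- by move=> p; exact: f0.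
rewrite iterSr -IH//.
- apply: eq_integral => w _; apply: eq_integral => g _.
  exact: (congr1 f (prefix_comp_cons g w n x)).
- by apply: measurable_markov_op => //; exact: measurable_eval01.
- exact: markov_op_ge0.
Qed.

Lemma measurable_grid_variation n m : measurable_fun [set: seq_space C]
  (fun w : seq_space C => grid_variation (prefix_comp (w : nat -> C01 R) n) m).
Proof.
apply: measurable_sum => j; apply: measurableT_comp => //.
by apply: measurable_funB; apply: (measurableT_comp (@measurable_I01_val R));
  exact: measurable_prefix_comp1.
Qed.

Definition grid_bounded (K : nat) : set (seq_space C) :=
  [set w : nat -> C01 R | forall n m, grid_variation (prefix_comp w n) m <= K%:R].

Lemma measurable_grid_bounded K : measurable (grid_bounded K).
Proof.
rewrite (_ : grid_bounded K = \bigcap_n \bigcap_m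
    [set w : seq_space C | grid_variation (prefix_comp (w : nat -> C01 R) n) m <= K%:R]).
  apply: bigcap_measurable => // n _; apply: bigcap_measurable => // m _.
  rewrite (_ : [set w | _] = (fun w : seq_space C =>
    grid_variation (prefix_comp (w : nat -> C01 R) n) m) @^-1` `]-oo, K%:R]).
    rewrite -[X in measurable X]setTI; exact: measurable_grid_variation.
  by apply/seteqP; split=> w /=; rewrite in_itv.
by apply/seteqP; split=> w /= H n; [move=> _ m _; exact: H|move=> m; exact: (H n Logic.I m Logic.I)].
Qed.

(** Shows that the event of the hypothesis is measurable: suprema over all partitions turn into
    countably many conditions on grids. *)
Lemma bounded_prefix_variationE : bounded_prefix_variation mu =
  [set w : seq_space C | forall n, supp mu (w n)] `&` \bigcup_K grid_bounded K.
Proof.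
apply/seteqP; split=> w; rewrite /bounded_prefix_variation /=.
  move=> [sw bw]; split => //.
  set V := ereal_sup _ in bw.
  have [K VK] : exists K : nat, (V <= K%:R%:E)%E.
    case: V bw => [r _|//|_]; last by exists 0%N; exact: leNye.
    exists (Num.truncn `|r|).+1; rewrite lee_fin ltW//.
    exact: le_lt_trans (ler_norm _) (truncnS_gt _).
  (* [grid_bounded] also constrains the empty product, which the hypothesis leaves out; its grid
     variation is 1, whence [K.+1]. *)
  exists K.+1 => // -[|n] m.
    by rewrite /= grid_variation_id ler1n.
  apply: (@le_trans _ _ K%:R); last by rewrite ler_nat.
  rewrite -lee_fin; apply: le_trans (grid_variation_le _ _) _.
  apply: le_trans VK; apply: ereal_sup_ubound; exists n.+1 => //.
move=> [sw [K _ bw]]; split => //.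
apply: (@le_lt_trans _ _ K%:R%:E); last exact: ltry.
apply: ge_ereal_sup => _ [n _ <-]; apply: I01_variation_le => //.
exact: prefix_comp_continuous.
Qed.

Hypothesis P_bounded : (0 < P (bounded_prefix_variation mu))%E.

Lemma measurable_all_supp : measurable [set w : seq_space C | forall n, supp mu (w n)].
Proof.
rewrite (_ : [set w | _] = \bigcap_n [set w : seq_space C | supp mu (w n)]).
  apply: bigcap_measurable => // n _; rewrite -[X in measurable X]setTI.
  by apply: measurable_coordinate => //; exact: measurable_supp.
by apply/seteqP; split=> w /= H n; [move=> _|]; exact: H.
Qed.

Lemma measurable_bounded_prefix_variation :
  measurable (bounded_prefix_variation mu : set (seq_space C)).
Proof.
rewrite bounded_prefix_variationE; apply: measurableI.
  exact: measurable_all_supp.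
by apply: bigcup_measurable => K _; exact: measurable_grid_bounded.
Qed.

(** Separability of [C01] is bypassed: the event of the hypothesis requires all maps to lie in the
    support, so its probability is at most the [n]-th power of the mass of the support, for every
    [n]. A mass below 1 would make the event null. *)
Lemma supp_full : mu (supp mu : set C) = 1%E.
Proof.
have mS := measurable_supp mu.
apply/eqP; rewrite eq_le probability_le1//= leNgt; apply/negP => S1.
have fS : mu (supp mu : set C) \is a fin_num by exact: fin_num_measure.
pose a := fine (mu (supp mu : set C)).
have aE : mu (supp mu : set C) = a%:E by rewrite fineK.
have a1 : `|a| < 1.
  by rewrite ger0_norm ?fine_ge0// -lte_fin -aE.
have le n : (P (bounded_prefix_variation mu) <= (a ^+ n)%:E)%E.
  have -> : ((a ^+ n)%:E = P (rectangle n (fun=> (supp mu : set C))))%E.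
    by rewrite P_product// big_const card_ord aE; elim: n => //= n <-; rewrite exprS EFinM.
  apply: le_measure; rewrite ?inE.
  - exact: measurable_bounded_prefix_variation.
  - exact: measurable_rectangle.
  - by rewrite bounded_prefix_variationE => w [sw _] i _; exact: sw.
have c : (a ^+ n)%:E @[n --> \oo] --> 0%:E.
  by apply: cvg_EFin; [exact: nearW|exact: cvg_expr].
move: P_bounded; apply/negP; rewrite -leNgt.
have -> : 0%E = limn (fun n => (a ^+ n)%:E) by rewrite (cvg_lim _ c).
apply: lime_ge; first by apply/cvg_ex; eexists; exact: c.
exact: nearW.
Qed.

Lemma grid_bounded_gt0 : exists K, (0 < P (grid_bounded K))%E.
Proof.
apply: contrapT => nK.
have P0 K : P (grid_bounded K) = 0%E.
  apply/eqP; rewrite eq_le measure_ge0 andbT leNgt; apply/negP => PK.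
  by apply: nK; exists K.
have mU : measurable (\bigcup_K grid_bounded K).
  by apply: bigcup_measurable => K _; exact: measurable_grid_bounded.
move: P_bounded; apply/negP; rewrite -leNgt.
apply: (@le_trans _ _ (P (\bigcup_K grid_bounded K))).
  apply: le_measure; rewrite ?inE//; first exact: measurable_bounded_prefix_variation.
  by rewrite bounded_prefix_variationE => w [].
apply: (@le_trans _ _ (\sum_(K <oo) P (grid_bounded K))%E).
  by apply: measure_sigma_subadditive => //; exact: measurable_grid_bounded.
by rewrite eseries0// => K _ _; exact: P0.
Qed.

End random_walk.

(** * Uniqueness *)

Section measure_add_finite.
Context d (T : measurableType d) (R : realType).
Variables m1 m2 : {finite_measure set T -> \bar R}.

(** Separating sets will be chosen for the sum of the two Jordan parts, so that one pair suits
    both. *)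
Lemma measure_add_fin_num : fin_num_fun (measure_add m1 m2).
Proof.
by move=> A mA; rewrite measure_addE fin_numD !fin_num_measure.
Qed.

HB.instance Definition _ := Measure.on (measure_add m1 m2).

HB.instance Definition _ :=
  Measure_isFinite.Build _ _ _ (measure_add m1 m2) measure_add_fin_num.

End measure_add_finite.

Section uniqueness.
Variable R : realType.
Local Notation X := (borel (I01 R)).
Local Notation C := (borel (C01 R)).
Variables (mu : probability C R) (r : I01 R -> R).
Hypothesis r_isom : forall x y, `|r x - r y| = `|I01_val x - I01_val y|.
Hypothesis r_itv : forall x, 0 <= r x <= 1.
Hypothesis r_surj : forall s : R, 0 <= s <= 1 -> exists x, r x = s.
Hypothesis r_move : forall x, 0 < r x < 1 ->
  exists2 g : C01 R, supp mu g & r (g x) < r x.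
Hypothesis r_mono : (forall x y, r x < r y -> I01_val x < I01_val y) \/
  (forall x y, r x < r y -> I01_val y < I01_val x).

Local Notation U := (markov_op mu (@eval01 R)).

Definition escape (A : set X) (x : X) : \bar R := (\1_(~` A) x)%:E.

Lemma escape_ge0 A x : (0 <= escape A x)%E.
Proof. by rewrite lee_fin indicE. Qed.

Lemma escape_le1 A x : (escape A x <= 1)%E.
Proof. by rewrite lee_fin indicE; case: (_ \in _). Qed.

Lemma measurable_escape A : measurable A -> measurable_fun [set: X] (escape A).
Proof.
by move=> mA; apply/measurable_EFinP; apply: measurable_indic; exact: measurableC.
Qed.

(** [B] is [garsia_bounded] for [escape A] at rate [e]. It has positive mass because [escape A] has
    mean below [e], and it absorbs orbits, so the restriction of [s] to it is excessive and charges
    every neighbourhood of the endpoint. *)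
Lemma rarely_escaping_points (s : {finite_measure set X -> \bar R}) A (e : R) :
  excessive mu (@eval01 R) s -> measurable A -> 0 < e ->
  s [set x | r x = 0] = 0%E -> s [set x | r x = 1] = 0%E ->
  (s (~` A) < e%:E * s [set: X])%E ->
  exists B : set X,
    (forall x, B x -> exists k : nat, forall N,
      (\sum_(n < N) iter n U (escape A) x <= (k%:R + N%:R * e)%:E)%E) /\
    (forall eta : R, 0 < eta -> exists2 x, B x & 0 < r x < eta).
Proof.
move=> exc mA e0 s0 s1 sA.
have mev := @measurable_eval01 R.
have mf := measurable_escape mA.
pose B := garsia_bounded mu (@eval01 R) (escape A) e.
have mB : measurable B.
  exact: (measurable_garsia_bounded mu mev e mf).
have B0 : (0 < s B)%E.
  apply: (garsia_bounded_measure mev mf (escape_ge0 A) (@escape_le1 A) e0 exc).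
  rewrite integral_indic//; last exact: measurableC.
  by rewrite setIT.
have fB : (s B < +oo)%E.
  by rewrite -ge0_fin_numE ?measure_ge0//; exact: fin_num_measure.
pose la : {finite_measure set X -> \bar R} := mfrestr mB fB.
have la_exc : excessive mu (@eval01 R) la.
  apply: excessive_restr => // x Bx.
  exact: (garsia_bounded_absorbing mev mf (escape_ge0 A) Bx).
have laE D : la D = s (D `&` B) by [].
have la0 D : measurable D -> s D = 0%E -> la D = 0%E.
  move=> mD sD; apply/eqP; rewrite eq_le measure_ge0 andbT -sD laE.
  by apply: le_measure; rewrite ?inE//; exact: measurableI.
exists B; split.
  move=> x Bx.
  have [k limk] : exists k : nat, (limn (garsia mu (@eval01 R) (escape A) e ^~ x) <= k%:R%:E)%E.
    move: Bx; rewrite /B /garsia_bounded /=.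
    case: (limn _) => [l _|//|_]; last by exists 0%N; exact: leNye.
    exists (Num.truncn `|l|).+1; rewrite lee_fin ltW//.
    exact: le_lt_trans (ler_norm _) (truncnS_gt _).
  exists k => N.
  apply: le_trans (sum_iter_markov_op mu mev mf (escape_ge0 A) e0 N x) _.
  rewrite [leRHS]EFinD leeD2r//; apply: le_trans limk.
  exact: (garsia_lim mu mev e mf).
move=> eta eta0.
have : (0 < la [set x : X | (0 < r x < eta)%R])%E.
  apply: (excessive_mass_near_endpoint r_isom r_itv r_surj r_move) => //.
  - by rewrite laE setTI.
  - by apply: la0 => //; exact: measurable_r_eq.
  - by apply: la0 => //; exact: measurable_r_eq.
rewrite laE => pos.
have [[x [xe Bx]]|nx] := pselect (exists x, ([set x : X | (0 < r x < eta)%R] `&` B) x).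
  by exists x.
move: pos; rewrite (_ : _ `&` _ = set0) ?measure0 ?ltxx//.
by apply/seteqP; split=> // x Hx; apply: nx; exists x.
Qed.

Variable P : probability (seq_space C) R.
Hypothesis P_product : is_product_measure mu P.

(** Let [Z n] count the points of the first [M] pairs that miss their target set at time [n], and
    let [p] be the probability of [grid_bounded K]. Summed over [n < N], the expectations of [Z n]
    are at least [N * M * p / 2], hence at least [8 * M * N * e], but also at most
    [2 * M * (k + N * e)], which is less than [4 * M * N * e]. *)
Lemma alternating_contradiction (K : nat) (e d : R) (A D : set X) (x y : nat -> I01 R) :
  (0 < P (grid_bounded K))%E -> 0 < d -> apart_by A D d ->
  measurable A -> measurable D -> 0 < e -> ((16 * e)%:E <= P (grid_bounded K))%E ->
  (forall i, r (y i) < r (x i)) -> (forall i, r (x i.+1) < r (y i)) ->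
  (forall i, exists k : nat, forall N,
      (\sum_(n < N) iter n U (escape A) (x i) <= (k%:R + N%:R * e)%:E)%E) ->
  (forall i, exists k : nat, forall N,
      (\sum_(n < N) iter n U (escape D) (y i) <= (k%:R + N%:R * e)%:E)%E) ->
  False.
Proof.
move=> PK d0 sep mA mD e0 e16 yx xy hx hy.
have mev := @measurable_eval01 R.
(* Variation at most [K] leaves room for at most [K / d] pairs without a miss, fewer than
   [M / 2]. *)
pose M := (Num.truncn (2 * K%:R / d)).+1.
have M_gt : 2 * K%:R / d < M%:R by exact: truncnS_gt.
have /choice[kx kxP] := hx; have /choice[ky kyP] := hy.
pose k := (\sum_(i < M) (kx i + ky i))%N.
have kx_le (i : 'I_M) : (kx i <= k)%N.
  by rewrite /k (bigD1 i)//= -addnA leq_addr.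
have ky_le (i : 'I_M) : (ky i <= k)%N.
  by rewrite /k (bigD1 i)//= addnAC leq_addl.
(* A time horizon long enough for [N * e] to exceed the additive constants of all [2 * M] points. *)
pose N := (Num.truncn (k%:R / e)).+1.
have N_gt : k%:R < N%:R * e by rewrite -ltr_pdivrMr//; exact: truncnS_gt.
pose Z n (w : seq_space C) : \bar R := (\sum_(i < M)
  (escape A (prefix_comp (w : nat -> C01 R) n (x i)) +
   escape D (prefix_comp (w : nat -> C01 R) n (y i))))%E.
have Z_ge n w : grid_bounded K w -> ((M%:R / 2)%:E <= Z n w)%E.
  move=> Kw.
  have := @grid_variation_bound R _ K%:R (@prefix_comp_continuous R w n) (Kw n) x y M.
  have mono : (forall i, I01_val (x i) <= I01_val (y i) <= I01_val (x i.+1)) \/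
      (forall i, I01_val (x i.+1) <= I01_val (y i) <= I01_val (x i)).
    case: r_mono => rm; [right|left] => i; apply/andP; split; apply/ltW; exact: rm.
  move=> /(_ mono) {mono}; rewrite big_mkord => var.
  rewrite /Z (eq_bigr (fun i : 'I_M => (\1_(~` A) (prefix_comp (w : nat -> C01 R) n (x i)) +
    \1_(~` D) (prefix_comp (w : nat -> C01 R) n (y i)) : R)%:E))//.
  rewrite sumEFin lee_fin.
  (* A pair without a miss contributes at least [d] to the variation; with one or two misses the
     summand is at most 0. *)
  have sumd : \sum_(i < M) (d * (1 - (\1_(~` A) (prefix_comp (w : nat -> C01 R) n (x i)) +
      \1_(~` D) (prefix_comp (w : nat -> C01 R) n (y i))))) <= K%:R.
    apply: le_trans var; apply: ler_sum => i _; rewrite !indicE.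
    set p := prefix_comp _ _ (x i); set q := prefix_comp _ _ (y i).
    have [/set_mem Ap|/negP Ap] := boolP (p \in ~` A).
      apply: (@le_trans _ _ 0) => //; apply: mulr_ge0_le0; first exact: ltW.
      by rewrite subr_le0 lerDl; case: (_ \in _).
    have [/set_mem Dq|/negP Dq] := boolP (q \in ~` D).
      by rewrite add0r subrr mulr0.
    rewrite addr0 subr0 mulr1; apply: sep.
      by apply: contrapT => nA; apply: Ap; exact/mem_set.
    by apply: contrapT => nD; apply: Dq; exact/mem_set.
  move: sumd; rewrite -mulr_sumr sumrB sumr_const card_ord.
  rewrite mulrC -ler_pdivlMr// lerBlDr -lerBlDl.
  apply: le_trans; rewrite lerBrDr -lerBrDl.
  have -> : M%:R - M%:R / 2 = M%:R / 2 :> R by rewrite [X in X - _]splitr addrK.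
  by rewrite ler_pdivlMr// mulrC mulrA ltW.
have mesc E n t : measurable E -> measurable_fun [set: seq_space C]
    (fun w : seq_space C => escape E (prefix_comp (w : nat -> C01 R) n t)).
  move=> mE; exact: (measurableT_comp (measurable_escape mE) (measurable_prefix_comp1 n t)).
have mZ n : measurable_fun [set: seq_space C] (Z n).
  by apply: emeasurable_sum => i; apply: emeasurable_funD; exact: mesc.
have EZ n : (\int[P]_w Z n w = \sum_(i < M)
    (iter n U (escape A) (x i) + iter n U (escape D) (y i)))%E.
  rewrite ge0_integral_sum//.
  - apply: eq_bigr => i _; rewrite ge0_integralD//; [|by move=> w _; exact: escape_ge0|
      exact: mesc|by move=> w _; exact: escape_ge0|exact: mesc].
    by congr (_ + _)%E; apply: expectation_prefix_comp => //;
      try exact: escape_ge0; exact: measurable_escape.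
  - by move=> i; apply: emeasurable_funD; exact: mesc.
  - by move=> i w _; rewrite adde_ge0// escape_ge0.
have mK := measurable_grid_bounded K.
pose p := fine (P (grid_bounded K)).
have pE : P (grid_bounded K) = p%:E.
  by rewrite fineK//; exact: fin_num_measure.
have EZ_ge n : ((M%:R / 2 * p)%:E <= \int[P]_w Z n w)%E.
  rewrite EFinM -pE.
  have -> : ((M%:R / 2)%:E * P (grid_bounded K) =
      \int[P]_(w in grid_bounded K) cst (M%:R / 2)%:E w)%E by rewrite integral_cst.
  apply: (@le_trans _ _ (\int[P]_(w in grid_bounded K) Z n w)%E).
    apply: ge0_le_integral => //.
    - by move=> w _; rewrite lee_fin divr_ge0.
    - exact: measurable_funTS.
    - by move=> w; exact: Z_ge.
  apply: ge0_subset_integral => //.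
  by move=> w _; apply: sume_ge0 => i _; rewrite adde_ge0// escape_ge0.
have tot : (\sum_(n < N) (M%:R / 2 * p)%:E <=
    \sum_(i < M) (((k%:R + N%:R * e)%:E) + (k%:R + N%:R * e)%:E))%E.
  apply: (@le_trans _ _ (\sum_(n < N) \sum_(i < M)
      (iter n U (escape A) (x i) + iter n U (escape D) (y i)))%E).
    by apply: lee_sum => n _; rewrite -EZ.
  rewrite exchange_big/=; apply: lee_sum => i _.
  rewrite big_split/=; apply: leeD.
    by apply: le_trans (kxP i N) _; rewrite lee_fin lerD2r ler_nat.
  by apply: le_trans (kyP i N) _; rewrite lee_fin lerD2r ler_nat.
move: tot; rewrite sumEFin.
under [X in (_ <= X)%E]eq_bigr do rewrite -EFinD.
rewrite sumEFin lee_fin !sumr_const !card_ord; apply/negP; rewrite -ltNge.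
have p16 : 16 * e <= p by rewrite -lee_fin -pE.
have Mp : 0 < (M%:R : R) by rewrite ltr0n.
have Np : 0 < (N%:R : R) by rewrite ltr0n.
rewrite -[ltLHS]mulr_natl -[ltRHS]mulr_natl.
apply: (@lt_le_trans _ _ (M%:R * (4 * (N%:R * e)))).
  rewrite ltr_pM2l//; lra.
rewrite [leRHS](_ : _ = M%:R * (N%:R * (p / 2))); last by ring.
rewrite ler_pM2l// mulrCA ler_pM2l//; lra.
Qed.

Lemma stationary_unique (nu1 nu2 : probability X R) A :
  (0 < P (bounded_prefix_variation mu))%E ->
  stationary mu (@eval01 R) nu1 -> stationary mu (@eval01 R) nu2 ->
  nu1 [set x | r x = 0] = 0%E -> nu1 [set x | r x = 1] = 0%E ->
  nu2 [set x | r x = 0] = 0%E -> nu2 [set x | r x = 1] = 0%E ->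
  measurable A -> nu1 A = nu2 A.
Proof.
move=> Pb st1 st2 n10 n11 n20 n21 mA; apply/eqP/negPn/negP => neq.
have mev := @measurable_eval01 R.
have [s1 [s2 [Q [[mQ exc1 exc2] [[s1Q s2Q s1T s2T] [le1 le2]]]]]] :=
  singular_excessive_parts mev st1 st2 mA neq.
have [K PK] := grid_bounded_gt0 Pb.
have fP : P (grid_bounded K) \is a fin_num.
  by apply: fin_num_measure; exact: measurable_grid_bounded.
pose e := fine (P (grid_bounded K)) / 16.
have e0 : 0 < e by rewrite divr_gt0// fine_gt0// PK ltey_eq fP.
have f1 : s1 [set: X] \is a fin_num by exact: fin_num_measure.
have f2 : s2 [set: X] \is a fin_num by exact: fin_num_measure.
(* The uncovered mass must be below the fraction [e] of the mass of each part. *)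
pose a := e * Num.min (fine (s1 [set: X])) (fine (s2 [set: X])).
have a0 : 0 < a.
  by rewrite mulr_gt0// lt_min !fine_gt0// ?s1T ?s2T ltey_eq ?f1 ?f2.
have [D1 [D2 [d [[mD1 mD2 D1Q D2Q] [d0 sep small]]]]] :=
  borel_inner_separable (measure_add s1 s2 : {finite_measure set X -> \bar R}) mQ a0.
have mD : measurable (~` (D1 `|` D2)) by apply/measurableC/measurableU.
have small1 : (s1 (~` D1) < e%:E * s1 [set: X])%E.
  apply: (@le_lt_trans _ _ (measure_add s1 s2 (~` (D1 `|` D2)))).
    (* [D2] lies in the complement of [Q], which is null for [s1], so the part of the complement of
       [D1] inside [D2] costs nothing. *)
    apply: (@le_trans _ _ (s1 (~` (D1 `|` D2) `|` ~` Q))).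
      apply: le_measure; rewrite ?inE//; first exact: measurableC.
        by apply: measurableU => //; exact: measurableC.
      move=> x nD1; have [D2x|nD2] := pselect (D2 x); first by right; exact: D2Q.
      by left => -[].
    apply: le_trans (measureU2 _ _ _) _ => //; first exact: measurableC.
    by rewrite [X in (_ + X)%E]s1Q adde0 measure_addE leeDl.
  apply: (lt_le_trans small); rewrite -(fineK f1) -EFinM lee_fin ler_pM2l//.
  by rewrite ge_min lexx.
have small2 : (s2 (~` D2) < e%:E * s2 [set: X])%E.
  apply: (@le_lt_trans _ _ (measure_add s1 s2 (~` (D1 `|` D2)))).
    apply: (@le_trans _ _ (s2 (~` (D1 `|` D2) `|` Q))).
      apply: le_measure; rewrite ?inE//; first exact: measurableC.
        exact: measurableU.
      move=> x nD2; have [D1x|nD1] := pselect (D1 x); first by right; exact: D1Q.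
      by left => -[].
    apply: le_trans (measureU2 _ _ _) _ => //.
    by rewrite [X in (_ + X)%E]s2Q adde0 measure_addE leeDr.
  apply: (lt_le_trans small); rewrite -(fineK f2) -EFinM lee_fin ler_pM2l//.
  by rewrite ge_min lexx orbT.
have null (s : {finite_measure set X -> \bar R}) (n : probability X R) t :
    (forall D, measurable D -> (s D <= n D)%E) -> n [set x | r x = t] = 0%E ->
    s [set x | r x = t] = 0%E.
  move=> le n0; apply/eqP; rewrite eq_le measure_ge0 andbT -n0.
  by apply: le; exact: measurable_r_eq.
have [B1 [B1k B1r]] := rarely_escaping_points exc1 mD1 e0
  (null _ _ _ le1 n10) (null _ _ _ le1 n11) small1.
have [B2 [B2k B2r]] := rarely_escaping_points exc2 mD2 e0
  (null _ _ _ le2 n20) (null _ _ _ le2 n21) small2.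
have [x [y [xB yB yx xy]]] := alternating_points B1r B2r.
apply: (alternating_contradiction PK d0 sep mD1 mD2 e0 _ yx xy).
- by rewrite /e mulrC divfK// fineK.
- by move=> i; exact: B1k.
- by move=> i; exact: B2k.
Qed.

End uniqueness.

(** * Step approximation of integrals *)

Section step_approximation.
Variable R : realType.
Local Notation X := (borel (I01 R)).
Implicit Types f : I01 R -> R.

(** The modulus is stated with a weak inequality so that it applies to neighbouring grid points. *)
Lemma I01_uniform_continuity f (e : R) : continuous f -> 0 < e ->
  exists m : nat, forall x y,
    `|I01_val x - I01_val y| <= m.+1%:R^-1 -> `|f x - f y| <= e.
Proof.
move=> cf e0; apply: contrapT => nm.
have /choice[xy xyP] : forall m : nat, exists p : I01 R * I01 R,
    `|I01_val p.1 - I01_val p.2| <= m.+1%:R^-1 /\ e < `|f p.1 - f p.2|.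
  move=> m; apply: contrapT => np; apply: nm; exists m => x y xy.
  rewrite leNgt; apply/negP => exy; apply: np; exists (x, y); split => //.
have [p [p01 clp]] : `[0 : R, 1]%classic `&`
    cluster (I01_val (xy n).1 @[n --> \oo]) !=set0.
  apply: segment_compact.
  by exists 0%N => // n _; rewrite /= in_itv/= I01_valP.
pose q := clamp01 p.
have qE : I01_val q = p by rewrite clamp01_val//; move: p01; rewrite /= in_itv.
have e20 : 0 < e / 2 by rewrite divr_gt0.
have [d d0 fd] : exists2 d : R, 0 < d &
    forall y, `|I01_val q - I01_val y| < d -> `|f q - f y| < e / 2.
  have /nbhs_I01P[d d0 H] : nbhs q [set y | `|f q - f y| < e / 2].
    by move/cvgrPdist_lt : (cf q) => /(_ _ e20).
  by exists d.
have d20 : 0 < d / 2 by rewrite divr_gt0.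
have [M _ MP] := near_infty_natSinv_lt (PosNum d20).
have [t [[n Mn <-] tp]] : ([set I01_val (xy n).1 | n in [set n | (M <= n)%N]]
    `&` ball p (d / 2)) !=set0.
  apply: clp; last exact: nbhsx_ballx.
  by exists M => // n Mn; exists n.
have [xyn exy] := xyP n.
have dx : `|I01_val q - I01_val (xy n).1| < d / 2 by rewrite qE.
have dy : `|I01_val q - I01_val (xy n).2| < d.
  apply: le_lt_trans (ler_distD (I01_val (xy n).1) _ _) _.
  rewrite [ltRHS]splitr; apply: ltrD => //.
  apply: le_lt_trans xyn _; exact: MP.
move: exy; apply/negP; rewrite -leNgt.
apply: le_trans (ler_distD (f q) _ _) _.
rewrite [leRHS]splitr; apply: lerD; apply/ltW; last exact: fd.
rewrite distrC; apply: fd; apply: (lt_trans dx).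
by rewrite ltr_pdivrMr// ltr_pMr// ltr1n.
Qed.

(** Summation by parts. For the distribution function of a probability it is the integral of the
    step function that takes on each grid cell the value of [f] at the right end. Being affine in
    [F], it passes to pointwise limits of distribution functions. *)
Definition step_sum f m (F : R -> R) : R := f (grid_point R m m.+1) +
  \sum_(0 <= j < m.+1)
    (f (grid_point R m j) - f (grid_point R m j.+1)) * F (j%:R / m.+1%:R).

Definition uniform_at f m (e : R) := forall x y,
  `|I01_val x - I01_val y| <= m.+1%:R^-1 -> `|f x - f y| <= e.

Lemma step_pointwise f m (e : R) x : uniform_at f m e ->
  `|f x - step_sum f m (fun s => (I01_val x <= s)%R%:R)| <= e.
Proof.
move=> fe; have /andP[x0 x1] := I01_valP x.
have ex : exists j, I01_val x <= j%:R / m.+1%:R.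
  by exists m.+1; rewrite divff.
case: (ex_minnP ex) => i xi imin.
have im : (i <= m.+1)%N by apply: imin; rewrite divff.
have iff j : (I01_val x <= j%:R / m.+1%:R) = (i <= j)%N.
  apply/idP/idP; first exact: imin.
  by move=> ij; apply: (le_trans xi); rewrite ler_pM2r ?invr_gt0// ler_nat.
have -> : step_sum f m (fun s => (I01_val x <= s)%R%:R) = f (grid_point R m i).
  rewrite /step_sum (big_cat_nat (n := i))//=.
  rewrite big_nat_cond big1 ?add0r; last first.
    by move=> j /andP[/andP[_ ji] _]; rewrite iff leqNgt ji mulr0.
  rewrite big_nat_cond (eq_bigr (fun j => - (f (grid_point R m j.+1) - f (grid_point R m j)))).
    by rewrite -big_nat_cond sumrN telescope_sumr// opprB addrC subrK.
  by move=> j /andP[/andP[ij _] _]; rewrite iff ij mulr1 opprB.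
apply: fe; rewrite grid_point_val//.
case: i xi imin im {iff} => [|i] xi imin im.
  have -> : I01_val x = 0 by apply/eqP; rewrite eq_le x0 andbT -(mul0r m.+1%:R^-1).
  by rewrite mul0r subrr normr0.
have ix : i%:R / m.+1%:R < I01_val x.
  by rewrite ltNge; apply/negP => /imin; rewrite ltnn.
rewrite distrC ger0_norm ?subr_ge0// lerBlDr -lerBlDl.
by rewrite -natr1 mulrDl mul1r addrK ltW.
Qed.

Definition low (pi : probability X R) (s : R) : R :=
  fine (pi [set x : X | (I01_val x <= s)%R]).

Lemma measurable_low s : measurable [set x : X | (I01_val x <= s)%R].
Proof.
rewrite (_ : [set x | _] = (@I01_val R : X -> R) @^-1` `]-oo, s]).
  by rewrite -[X in measurable X]setTI; exact: measurable_I01_val.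
by apply/seteqP; split=> x /=; rewrite in_itv.
Qed.

Lemma bounded_integrable (pi : probability X R) (f : X -> R) (c : R) :
  measurable_fun [set: X] f -> (forall x, `|f x| <= c) ->
  pi.-integrable setT (EFin \o f).
Proof.
move=> mf fc; apply: measurable_bounded_integrable => //.
  by rewrite -ge0_fin_numE ?measure_ge0//; exact: fin_num_measure.
exists c; split; first exact: num_real.
by move=> M cM x _; exact: le_trans (fc x) (ltW cM).
Qed.

Lemma continuous_bounded f : continuous f -> exists c : R, forall x, `|f x| <= c.
Proof.
move=> cf; have [m fm] := I01_uniform_continuity cf ltr01.
exists (1 + \sum_(j < m.+2) `|f (grid_point R m j)|) => x.
have /andP[x0 x1] := I01_valP x.
pose j := Num.truncn (m.+1%:R * I01_val x).
have jm : (j < m.+2)%N.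
  rewrite ltnS -(ler_nat R); apply: (@le_trans _ _ (m.+1%:R * I01_val x)).
    by rewrite truncn_le mulr_ge0.
  by rewrite ler_piMr.
rewrite -[f x](subrK (f (grid_point R m j))); apply: le_trans (ler_normD _ _) _.
apply: lerD.
  by apply: fm; rewrite grid_point_val//; exact: grid_dist.
by rewrite (bigD1 (Ordinal jm))//= lerDl sumr_ge0.
Qed.

Lemma step_integral (pi : probability X R) f m (e : R) : continuous f ->
  uniform_at f m e -> `|\int[pi]_x f x - step_sum f m (low pi)| <= e.
Proof.
move=> cf fe; have [c fc] := continuous_bounded cf.
have mf : measurable_fun [set: X] (f : X -> R) by exact: continuous_borel.
have intf := bounded_integrable pi mf fc.
pose h j (x : X) : R := \1_[set x : X | (I01_val x <= j%:R / m.+1%:R)%R] x.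
have mh j : measurable_fun [set: X] (h j).
  by apply: measurable_indic; exact: measurable_low.
have inth j : pi.-integrable setT (EFin \o h j).
  apply: (@bounded_integrable pi _ 1) => // x.
  by rewrite /h indicE; case: (_ \in _); rewrite ?normr1 ?normr0.
pose g (x : X) : R := step_sum f m (fun s => (I01_val x <= s)%R%:R).
pose a j := f (grid_point R m j) - f (grid_point R m j.+1).
pose gM M (x : X) : R := f (grid_point R m m.+1) + \sum_(0 <= j < M) a j * h j x.
have gE : g = gM m.+1.
  apply/funext => x; rewrite /g /gM /step_sum; congr (_ + _).
  apply: eq_bigr => j _; rewrite /h indicE; congr (_ * (nat_of_bool _)%:R).
  by apply/idP/idP => [xj|/set_mem//]; exact/mem_set.
have mgM M : measurable_fun [set: X] (gM M).
  apply: measurable_funD => //; under eq_fun do rewrite big_mkord.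
  by apply: measurable_sum => j; apply: measurable_funM.
have intM M : pi.-integrable setT (EFin \o gM M) /\
    \int[pi]_x gM M x = f (grid_point R m m.+1) +
      \sum_(0 <= j < M) a j * low pi (j%:R / m.+1%:R).
  elim: M => [|M [IH1 IH2]].
    have -> : gM 0%N = cst (f (grid_point R m m.+1)).
      by apply/funext => x; rewrite /gM big_geq// addr0.
    rewrite big_geq// addr0; split.
      exact: (@bounded_integrable pi _ `|f (grid_point R m m.+1)|).
    by rewrite Rintegral_cst//= [pi _]probability_setT mulr1.
  have -> : gM M.+1 = fun x => gM M x + a M * h M x.
    by apply/funext => x; rewrite /gM big_nat_recr//= addrA.
  have intah : pi.-integrable setT (EFin \o (fun x => a M * h M x)).
    apply: (@bounded_integrable pi _ `|a M|).
      exact: measurable_funM.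
    move=> x; rewrite normrM ler_piMr//.
    by rewrite /h indicE; case: (_ \in _); rewrite ?normr1 ?normr0.
  split.
    have -> : EFin \o (fun x => gM M x + a M * h M x) =
        ((EFin \o gM M) \+ (EFin \o (fun x => (a M * h M x)%R)))%E by [].
    exact: integrableD.
  rewrite RintegralD// IH2 big_nat_recr//= addrA; congr (_ + _).
  rewrite RintegralZl//; last exact: inth.
  congr (_ * _).
  by rewrite /Rintegral integral_indic ?setIT//; exact: measurable_low.
have [intg Eg] := intM m.+1; rewrite -gE in intg Eg.
have -> : step_sum f m (low pi) = \int[pi]_x g x by rewrite Eg.
rewrite -RintegralB//; apply: le_trans (le_normr_Rintegral _ _) _ => //.
  have -> : EFin \o (fun x => f x - g x) = ((EFin \o f) \- (EFin \o g))%E by [].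
  exact: integrableB.
have -> : e = \int[pi]_(x in setT) e.
  by rewrite Rintegral_cst//= [pi _]probability_setT mulr1.
have mfg : measurable_fun [set: X] (fun x => f x - g x).
  by apply: measurable_funB => //; rewrite gE.
apply: le_Rintegral => //.
- apply: (@bounded_integrable pi _ e) => //.
    exact: measurableT_comp.
  by move=> x; rewrite normr_id; exact: step_pointwise.
- apply: (@bounded_integrable pi _ `|e|) => //.
- by move=> x _; exact: step_pointwise.
Qed.

(* The errors [F s_j - F0 s_j] telescope: their sum is at most [F0 1 - F0 0]. *)
Lemma step_sum_compare f m (e : R) (F F0 : R -> R) : uniform_at f m e ->
  (forall s, F0 s <= F s) -> (forall s t, s < t -> F s <= F0 t) ->
  (forall s, 0 <= F0 s <= 1) ->
  `|step_sum f m F - step_sum f m F0| <= e.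
Proof.
move=> fe F0F FF0 F01.
have e0 : 0 <= e by apply: le_trans (fe (clamp01 0) (clamp01 0) _);
  rewrite ?subrr ?normr0.
rewrite /step_sum opprD addrACA subrr add0r -sumrB.
apply: le_trans (ler_norm_sum _ _ _) _.
apply: (@le_trans _ _ (\sum_(0 <= j < m.+1)
    e * (F0 (j.+1%:R / m.+1%:R) - F0 (j%:R / m.+1%:R)))).
  rewrite !big_mkord; apply: ler_sum => j _; rewrite -mulrBr normrM.
  apply: ler_pM => //.
    apply: fe; rewrite !grid_point_val; last 2 first.
    - exact: ltn_ord.
    - by rewrite ltnW// ltnS ltnW.
    by rewrite distrC -mulrBl -natrB// subSnn mul1r ger0_norm.
  rewrite ger0_norm ?subr_ge0// lerD2r; apply: FF0.
  by rewrite ltr_pM2r ?invr_gt0// ltr_nat.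
rewrite -mulr_sumr telescope_sumr// ler_piMr//.
have /andP[a0 a1] := F01 (m.+1%:R / m.+1%:R).
have /andP[b0 b1] := F01 (0%:R / m.+1%:R).
by rewrite lerBlDr (le_trans a1)// lerDl.
Qed.

End step_approximation.

Section ultra_limit.
Variable R : realType.

Lemma ultra_bounded_cvg (G : set_system nat) (u : nat -> R) :
  UltraFilter G -> (forall n, 0 <= u n <= 1) ->
  exists2 l : R, 0 <= l <= 1 & u @ G --> l.
Proof.
move=> UG u01.
have [l [l01 cl]] : `[0 : R, 1]%classic `&` cluster (u @ G) !=set0.
  apply: segment_compact.
  by apply: nearW => n; rewrite /= in_itv/=.
exists l; first by move: l01; rewrite /= in_itv.
move=> V lV; have [//|nV] := in_ultra_setVsetC (u @^-1` V) UG.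
have [t [[n nn <-] Vn]] : ([set u n | n in ~` (u @^-1` V)] `&` V) !=set0.
  apply: cl => //.
  have : G (u @^-1` [set u n | n in ~` (u @^-1` V)]).
    by apply: filterS nV => n nVn; exists n.
  by [].
by [].
Qed.

End ultra_limit.

(** * Weak compactness *)

(** [clamp01] with its Borel types displayed, to carry measures on the line over to the interval. *)
Definition borel_clamp01 (R : realType) : measurableTypeR R -> borel (I01 R) :=
  @clamp01 R.

HB.instance Definition _ (R : realType) := @isMeasurableFun.Build _ _
  (measurableTypeR R) (borel (I01 R)) (@borel_clamp01 R) (@measurable_clamp01 R).

Section right_regularization.
Variables (R : realType) (F0 : R -> R).
Hypothesis F0_nd : forall s t, s <= t -> F0 s <= F0 t.
Hypothesis F0_ge0 : forall s, 0 <= F0 s.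
Hypothesis F0_lt0 : forall s : R, s < 0 -> F0 s = 0.
Hypothesis F0_ge1 : forall s, 1 <= s -> F0 s = 1.

(** A pointwise limit of distribution functions is monotone but may fail to be right continuous; its
    right limits form a genuine distribution function. *)
Definition right_reg (s : R) : R := inf [set F0 t | t in [set t | s < t]].

Lemma right_reg_has_inf s : has_inf [set F0 t | t in [set t | s < t]].
Proof.
split; first by exists (F0 (s + 1)), (s + 1) => //=; rewrite ltrDl.
by exists 0 => _ [t _ <-].
Qed.

Lemma right_reg_le s t : s < t -> right_reg s <= F0 t.
Proof.
by move=> st; apply: ge_inf; [case: (right_reg_has_inf s)|exists t].
Qed.

Lemma le_right_reg s c : (forall t, s < t -> c <= F0 t) -> c <= right_reg s.
Proof.
move=> H; apply: lb_le_inf; first by case: (right_reg_has_inf s).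
by move=> _ [t st <-]; exact: H.
Qed.

Lemma F0_le_right_reg s : F0 s <= right_reg s.
Proof. by apply: le_right_reg => t /ltW; exact: F0_nd. Qed.

Lemma right_reg_nd : {homo right_reg : s t / s <= t}.
Proof.
by move=> s t st; apply: le_right_reg => u tu; apply: right_reg_le; exact: le_lt_trans tu.
Qed.

Lemma right_reg_rc : right_continuous right_reg.
Proof.
move=> s; apply/cvgrPdist_lt => e e0.
have [_ [t st <-] te] := inf_adherent e0 (right_reg_has_inf s).
near=> u.
have su : s < u by near: u; exact: nbhs_right_gt.
have ut : u < t by near: u; exact: nbhs_right_lt.
rewrite distrC ger0_norm ?subr_ge0; last exact/right_reg_nd/ltW.
rewrite ltrBlDl; apply: le_lt_trans te; exact: right_reg_le.
Unshelve. all: by end_near. Qed.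

Lemma right_reg_lt0 s : s < 0 -> right_reg s = 0.
Proof.
move=> s0; apply/eqP; rewrite eq_le; apply/andP; split; last exact: le_right_reg.
have s20 : s / 2 < 0 by rewrite pmulr_llt0// invr_gt0.
rewrite -(F0_lt0 s20); apply: right_reg_le.
by rewrite ltr_pdivlMr// mulr_natr mulr2n gtrDl.
Qed.

Lemma right_reg_ge1 s : 1 <= s -> right_reg s = 1.
Proof.
move=> s1; apply/eqP; rewrite eq_le; apply/andP; split.
  have ss : s < s + 1 by rewrite ltrDl.
  by rewrite -(F0_ge1 (le_trans s1 (ltW ss))); exact: right_reg_le.
by apply: le_right_reg => t st; rewrite F0_ge1// (le_trans s1)// ltW.
Qed.

Lemma right_reg_cvgNy : right_reg @ -oo --> (0 : R).
Proof.
apply: cvg_near_cst; near=> s; apply: right_reg_lt0.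
by near: s; exact: nbhs_ninfty_lt.
Unshelve. all: by end_near. Qed.

Lemma right_reg_cvgy : right_reg @ +oo --> (1 : R).
Proof.
apply: cvg_near_cst; near=> s; apply: right_reg_ge1.
by near: s; exact: nbhs_pinfty_ge.
Unshelve. all: by end_near. Qed.

HB.instance Definition _ := isCumulative.Build R _ R right_reg right_reg_nd right_reg_rc.
HB.instance Definition _ := isCumulativeBounded.Build R 0 1 right_reg
  right_reg_cvgNy right_reg_cvgy.

Let ls := lebesgue_stieltjes_measure right_reg.

(** The Lebesgue-Stieltjes measure is pushed forward by clamping. For [s] in this range the points
    clamped to at most [s] form the half-line up to [s], and [step_sum] evaluates [F] only there. *)
Lemma law_of_right_reg : exists nu : probability (borel (I01 R)) R,
  forall s, 0 <= s < 1 -> low nu s = right_reg s.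
Proof.
exists (distribution ls (@borel_clamp01 R)) => s /andP[s0 s1].
have cE : @borel_clamp01 R @^-1` [set x | I01_val x <= s] =
    (`]-oo, s]%classic : set R).
  apply/seteqP; split=> t; rewrite /= in_itv/= /I01_val/= ge_max s0/= ge_min.
    by rewrite leNgt s1.
  by move=> ->; rewrite orbT.
have lsE : ls (`]-oo, s]%classic : set R) = (right_reg s)%:E.
  exact: (cdf_lebesgue_stieltjes_id (right_reg : cumulativeBounded 0 1) s).
transitivity (fine (ls (`]-oo, s]%classic : set R))); last by rewrite lsE.
by congr (fine (ls _)).
Qed.

End right_regularization.

Section weak_compactness.
Variable R : realType.
Local Notation X := (borel (I01 R)).

(* [nu] is the Lebesgue-Stieltjes measure of the limit of the cumulative
   distribution functions along an ultrafilter. *)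
Lemma weak_ultralimit (pi : nat -> probability X R) :
  exists (nu : probability X R) (G : set_system nat),
    [/\ UltraFilter G, \oo `<=` G &
    forall f : I01 R -> R, continuous f -> forall e : R, 0 < e ->
      G [set N | `|\int[pi N]_x f x - \int[nu]_x f x| <= e]].
Proof.
have [G [UG ooG]] := ultraFilterLemma (@eventually_filter).
have low01 N s : 0 <= low (pi N) s <= 1.
  rewrite /low fine_ge0//=; rewrite -lee_fin fineK ?probability_le1//.
    exact: measurable_low.
  by apply: fin_num_measure; exact: measurable_low.
have /choice[F0 F0P] : forall s, exists l : R, 0 <= l <= 1 /\
    low (pi N) s @[N --> G] --> l.
  move=> s; have [l l01 ul] := ultra_bounded_cvg UG (fun N => low01 N s).
  by exists l.
have F0_cvg s : low (pi N) s @[N --> G] --> F0 s by case: (F0P s).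
have F0_01 s : 0 <= F0 s <= 1 by case: (F0P s).
have low_nd N s t : s <= t -> low (pi N) s <= low (pi N) t.
  move=> st; rewrite /low fine_le ?fin_num_measure//; try exact: measurable_low.
  apply: le_measure; rewrite ?inE; try exact: measurable_low.
  by move=> x /= xs; exact: le_trans st.
have F0_nd s t : s <= t -> F0 s <= F0 t.
  move=> st; rewrite -(cvg_lim _ (F0_cvg s))// -(cvg_lim _ (F0_cvg t))//.
  apply: ler_lim; [by apply/cvg_ex; exists (F0 s)|by apply/cvg_ex; exists (F0 t)|].
  by apply: nearW => N; exact: low_nd.
have F0_lt0 s : s < 0 -> F0 s = 0.
  move=> s0; rewrite -(cvg_lim _ (F0_cvg s))//.
  rewrite (_ : (fun N => _) = cst 0) ?lim_cst//; apply/funext => N.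
  rewrite /low (_ : [set x | _] = set0) ?measure0//; apply/seteqP; split=> // x /= xs.
  by have /andP[+ _] := I01_valP x; rewrite leNgt (le_lt_trans xs).
have F0_ge1 s : 1 <= s -> F0 s = 1.
  move=> s1; rewrite -(cvg_lim _ (F0_cvg s))//.
  rewrite (_ : (fun N => _) = cst 1) ?lim_cst//; apply/funext => N.
  rewrite /low (_ : [set x | _] = setT) ?[pi _ _]probability_setT//.
  apply/seteqP; split=> // x _ /=.
  by have /andP[_ x1] := I01_valP x; exact: le_trans s1.
have F0_ge0 s : 0 <= F0 s by case/andP: (F0_01 s).
have [nu nuE] := law_of_right_reg F0_ge0 F0_lt0 F0_ge1.
exists nu, G; split => // f cf e e0.
have e40 : 0 < e / 4 by rewrite divr_gt0.
have [m fm] := I01_uniform_continuity cf e40.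
have ss : step_sum f m (low (pi N)) @[N --> G] --> step_sum f m F0.
  apply: cvgD; first exact: cvg_cst.
  by apply: cvg_sumr => j; apply: cvgM; [exact: cvg_cst|exact: F0_cvg].
have e4N : G [set N | `|step_sum f m F0 - step_sum f m (low (pi N))| <= e / 4].
  move/cvgrPdist_le : ss => /(_ _ e40); exact.
apply: filterS e4N => N /= sN.
have nuS : step_sum f m (low nu) = step_sum f m (right_reg F0).
  rewrite /step_sum; congr (_ + _); apply: eq_big_nat => j /andP[_ jm].
  by rewrite nuE// divr_ge0//= ltr_pdivrMr// mul1r ltr_nat.
(* Grid points may be jumps of [F0], where [low nu] and [F0] differ. *)
have cmp : `|step_sum f m (low nu) - step_sum f m F0| <= e / 4.
  rewrite nuS; apply: step_sum_compare => //.
    by move=> s; exact: F0_le_right_reg.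
  by move=> s t; exact: right_reg_le.
have i1 := step_integral (pi N) cf fm.
have i2 := step_integral nu cf fm.
have -> : e = (e / 4 + e / 4) + (e / 4 + e / 4) by lra.
apply: le_trans (ler_distD (step_sum f m F0) _ _) _; apply: lerD.
  apply: le_trans (ler_distD (step_sum f m (low (pi N))) _ _) _.
  by rewrite lerD// distrC.
apply: le_trans (ler_distD (step_sum f m (low nu)) _ _) _.
by rewrite lerD// distrC.
Qed.

End weak_compactness.

(** * Existence *)

Section cesaro.
Context d (T : measurableType d) (R : realType).
Variables (k : nat -> probability T R) (N : nat).

Definition cesaro : set T -> \bar R := mscale (N.+1%:R^-1)%:nng (msum k N.+1).

HB.instance Definition _ := Measure.on cesaro.

Lemma cesaro_setT : cesaro [set: T] = 1%E.
Proof.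
have sE : msum k N.+1 [set: T] = (N.+1%:R : R)%:E.
  transitivity (\sum_(n < N.+1) (1 : R)%:E)%E.
    by apply: eq_bigr => i _; exact: probability_setT.
  by rewrite sumEFin sumr_const card_ord.
by rewrite /cesaro /mscale [X in (_ * X)%E]sE -EFinM mulVf.
Qed.

HB.instance Definition _ := Measure_isProbability.Build _ _ _ cesaro cesaro_setT.

Lemma ge0_integral_cesaro (f : T -> \bar R) : measurable_fun [set: T] f ->
  (forall x, 0 <= f x)%E ->
  (\int[cesaro]_x f x = (N.+1%:R^-1)%:E * \sum_(n < N.+1) \int[k n]_x f x)%E.
Proof.
by move=> mf f0; rewrite ge0_integral_mscale// ge0_integral_measure_sum.
Qed.

End cesaro.

Section existence.
Variable R : realType.
Local Notation X := (borel (I01 R)).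
Local Notation C := (borel (C01 R)).
Variables (mu : probability C R) (P : probability (seq_space C) R).
Hypothesis P_product : is_product_measure mu P.

Local Notation U := (markov_op mu (@eval01 R)).

(** Only the law at each time enters the averages, so the products of the hypothesis can stand in
    for the orbit of 0. *)
Definition walk (n : nat) (w : seq_space C) : X :=
  prefix_comp (w : nat -> C01 R) n (I01_0 R).

HB.instance Definition _ n := @isMeasurableFun.Build _ _ (seq_space C) X (walk n)
  (measurable_prefix_comp1 n (I01_0 R)).

Definition walk_law n : probability X R := distribution P (walk n).

Lemma integral_walk_law n (f : X -> \bar R) : measurable_fun [set: X] f ->
  (forall x, 0 <= f x)%E ->
  (\int[walk_law n]_x f x = iter n U f (I01_0 R))%E.
Proof.
by move=> mf f0; rewrite ge0_integral_distribution// -(expectation_prefix_comp P_product).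
Qed.

(** Applying [U] shifts the averaged sequence by one, so only its first and last terms fail to
    cancel, and both lie between 0 and 1. Two one-sided bounds replace a difference of extended
    reals. *)
Lemma cesaro_almost_invariant (f : X -> \bar R) N : measurable_fun [set: X] f ->
  (forall x, 0 <= f x <= 1)%E ->
  (\int[cesaro walk_law N]_x U f x <= \int[cesaro walk_law N]_x f x + (N.+1%:R^-1)%:E)%E /\
  (\int[cesaro walk_law N]_x f x <= \int[cesaro walk_law N]_x U f x + (N.+1%:R^-1)%:E)%E.
Proof.
move=> mf f01; have mev := @measurable_eval01 R.
have f0 x : (0 <= f x)%E by case/andP: (f01 x).
have f1 x : (f x <= 1)%E by case/andP: (f01 x).
have mU := measurable_markov_op mu mev mf f0.
have U0 := markov_op_ge0 mu (@eval01 R) f0.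
pose a n := iter n U f (I01_0 R).
have a01 n : (0 <= a n <= 1)%E.
  suff : (forall x, 0 <= iter n U f x <= 1)%E /\ measurable_fun [set: X] (iter n U f).
    by move=> [+ _]; exact.
  elim: n => [//|n [IH mIH]] /=.
  have IH0 x : (0 <= iter n U f x)%E by case/andP: (IH x).
  split; last exact: measurable_markov_op.
  move=> x; rewrite markov_op_ge0//= -[leRHS](markov_op_cst mu (@eval01 R) _ x).
  by apply: le_markov_op => // y; case/andP: (IH y).
have a0 n : (0 <= a n)%E by case/andP: (a01 n).
have a1 n : (a n <= 1)%E by case/andP: (a01 n).
have c0 : (0 <= (N.+1%:R^-1 : R)%:E)%E by rewrite lee_fin.
rewrite !ge0_integral_cesaro//.
have S0 : (\sum_(n < N.+1) \int[walk_law n]_x f x = \sum_(n < N.+1) a n)%E.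
  by apply: eq_bigr => n _; rewrite integral_walk_law.
have S1 : (\sum_(n < N.+1) \int[walk_law n]_x U f x = \sum_(n < N.+1) a n.+1)%E.
  by apply: eq_bigr => n _; rewrite integral_walk_law// -iterSr.
rewrite !S1 !S0.
have tel : (a 0%N + \sum_(n < N.+1) a n.+1 = \sum_(n < N.+1) a n + a N.+1)%E.
  transitivity (\sum_(n < N.+2) a n)%E; first by rewrite [RHS]big_ord_recl; congr (_ + _)%E; exact: eq_bigr.
  by rewrite big_ord_recr.
have step (s t : \bar R) : (s <= t + 1)%E -> (0 <= t)%E ->
    ((N.+1%:R^-1)%:E * s <= (N.+1%:R^-1)%:E * t + (N.+1%:R^-1)%:E)%E.
  move=> st t0; rewrite -[X in (_ + X)%E]mule1 -ge0_muleDr//.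
  exact: lee_wpmul2l.
split; apply: step; try exact: sume_ge0.
  apply: (@le_trans _ _ (a 0%N + \sum_(n < N.+1) a n.+1)%E); first exact: leeDr.
  by rewrite tel leeD2l.
apply: (@le_trans _ _ (\sum_(n < N.+1) a n + a N.+1)%E).
  exact: leeDl.
by rewrite -tel addeC leeD2l.
Qed.

Definition averaged (f : I01 R -> R) (x : I01 R) : R := fine (U (EFin \o f) x).

Lemma markov_op_EFin (f : X -> R) x : measurable_fun [set: X] f ->
  (forall x, 0 <= f x <= 1) -> U (EFin \o f) x \is a fin_num.
Proof.
move=> mf f01.
have U0 : (0 <= U (EFin \o f) x)%E.
  by apply: markov_op_ge0 => y; rewrite lee_fin; case/andP: (f01 y).
rewrite ge0_fin_numE//; apply: (@le_lt_trans _ _ 1%E); last exact: ltry.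
rewrite -[leRHS](markov_op_cst mu (@eval01 R) _ x).
apply: (le_markov_op mu (@measurable_eval01 R)) => //.
- exact/measurable_EFinP.
- by move=> y; rewrite lee_fin; case/andP: (f01 y).
- by move=> y; rewrite lee_fin; case/andP: (f01 y).
Qed.

(** The Feller property: dominated convergence along sequences, each map being continuous and [f]
    bounded. *)
Lemma averaged_continuous (f : I01 R -> R) : continuous f -> (forall x, 0 <= f x <= 1) ->
  continuous (averaged f).
Proof.
move=> cf f01 x.
have mf : measurable_fun [set: X] (f : X -> R) by exact: continuous_borel.
apply/(@cvgrPdist_lt _ _ _ (nbhs x) (nbhs_filter x)) => e e0; apply: contrapT => nH.
have /choice[y yP] : forall n : nat, exists y : I01 R,
    `|I01_val x - I01_val y| < n.+1%:R^-1 /\ e <= `|averaged f x - averaged f y|.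
  move=> n; apply: contrapT => ny; apply: nH; apply/nbhs_I01P.
  exists n.+1%:R^-1; first by rewrite invr_gt0.
  move=> y xy; rewrite ltNge; apply/negP => ey; apply: ny; by exists y.
have yx (g : C01 R) : f (g (y n)) @[n --> \oo] --> f (g x).
  apply/cvgrPdist_lt => c c0.
  have /nbhs_I01P[d d0 fd] : nbhs (g x) [set z | `|f (g x) - f z| < c].
    by move/cvgrPdist_lt : (cf (g x)) => /(_ _ c0).
  have [d' d'0 gd] := C01_continuity g x d0.
  near=> n; apply: fd; apply: gd.
  apply: lt_trans (yP n).1 _.
  by near: n; exact: near_infty_natSinv_lt (PosNum d'0).
pose F n (g : C) : \bar R := (f ((g : C01 R) (y n)))%:E.
have mF z : measurable_fun [set: C] (fun g : C => (f ((g : C01 R) z))%:E).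
  have mfe : measurable_fun [set: X] (EFin \o f) by exact/measurable_EFinP.
  exact: (measurable_ev1 (@measurable_eval01 R) z mfe).
have cF : (U (EFin \o f) (y n)) @[n --> \oo] --> U (EFin \o f) x.
  have := @dominated_convergence _ _ R mu setT measurableT F
    (fun g : C => (f ((g : C01 R) x))%:E) (cst 1%E) (fun n => mF (y n)) (mF x).
  case=> [|||_ _ //].
  - apply: aeW => g _; apply: cvg_EFin; first exact: nearW.
    exact: yx.
  - apply/integrableP; split => //.
    under eq_integral do rewrite /= normr1.
    rewrite integral_cst//= mul1e -ge0_fin_numE ?measure_ge0//.
    exact: fin_num_measure.
  - apply: aeW => g n _; rewrite /F /= lee_fin ger0_norm.
      by case/andP: (f01 ((g : C01 R) (y n))).
    by case/andP: (f01 ((g : C01 R) (y n))).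
have : averaged f (y n) @[n --> \oo] --> averaged f x.
  apply: fine_cvg; rewrite /averaged fineK//; exact: markov_op_EFin.
move/cvgrPdist_lt => /(_ _ e0)[n _ /(_ n (leqnn n))].
by rewrite /= ltNge (yP n).2.
Unshelve. all: by end_near. Qed.

(** By the Feller property the weak limit of the averages can be tested on both [f] and
    [averaged f], and the defect of invariance tends to 0. *)
Lemma ex_averaging_measure : exists nu : probability X R,
  forall f : I01 R -> R, continuous f -> (forall x, 0 <= f x <= 1) ->
  (\int[nu]_x U (EFin \o f) x = \int[nu]_x (f x)%:E)%E.
Proof.
have [nu [G [UG ooG Gcvg]]] := weak_ultralimit (fun N => cesaro walk_law N : probability X R).
exists nu => f cf f01.
have mf : measurable_fun [set: X] (f : X -> R) by exact: continuous_borel.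
have mev := @measurable_eval01 R.
have cU := averaged_continuous cf f01.
have UE x : U (EFin \o f) x = (averaged f x)%:E.
  by rewrite fineK//; exact: markov_op_EFin.
have U01 x : 0 <= averaged f x <= 1.
  rewrite -!lee_fin -UE markov_op_ge0/=; last first.
    by move=> y; rewrite lee_fin; case/andP: (f01 y).
  rewrite -[leRHS](markov_op_cst mu (@eval01 R) _ x).
  apply: (le_markov_op mu mev) => //.
  - exact/measurable_EFinP.
  - by move=> y; rewrite lee_fin; case/andP: (f01 y).
  - by move=> y; rewrite lee_fin; case/andP: (f01 y).
have mU : measurable_fun [set: X] (averaged f : X -> R) by exact: continuous_borel.
have RE (m : probability X R) (h : X -> R) : measurable_fun [set: X] h ->
    (forall x, 0 <= h x <= 1) -> (\int[m]_x (h x)%:E = (\int[m]_x h x)%:E)%E.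
  move=> mh h01; rewrite /Rintegral fineK//.
  apply: integrable_fin_num => //; apply: (@bounded_integrable _ m h 1) => // x.
  by rewrite ger0_norm; case/andP: (h01 x).
have UIE (m : probability X R) :
    (\int[m]_x U (EFin \o f) x = \int[m]_x (averaged f x)%:E)%E.
  by apply: eq_integral => x _; rewrite UE.
rewrite UIE !RE//; congr (_%:E); apply/eqP; rewrite -subr_eq0 -normr_le0.
apply/ler_addgt0Pr => e e0; rewrite add0r.
have e30 : 0 < e / 3 by rewrite divr_gt0.
have GF : Filter G by exact: filter_filter.
have G1 := Gcvg _ cU _ e30; have G2 := Gcvg _ cf _ e30.
have G3 : G [set N | N.+1%:R^-1 <= e / 3].
  apply: ooG; have [N _ NP] := near_infty_natSinv_lt (PosNum e30).
  by exists N => // n Nn; apply/ltW; exact: NP.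
have [N [/= h1 h2 h3]] : exists N, [/\
    `|\int[cesaro walk_law N]_x averaged f x - \int[nu]_x averaged f x| <= e / 3,
    `|\int[cesaro walk_law N]_x f x - \int[nu]_x f x| <= e / 3 &
    N.+1%:R^-1 <= e / 3].
  have : G ([set N | `|\int[cesaro walk_law N]_x averaged f x - \int[nu]_x averaged f x| <= e / 3] `&`
      [set N | `|\int[cesaro walk_law N]_x f x - \int[nu]_x f x| <= e / 3] `&`
      [set N | N.+1%:R^-1 <= e / 3]).
    by apply: filterI => //; exact: filterI.
  by move/filter_ex => [N [[? ?] ?]]; exists N.
have f01e x : (0 <= (EFin \o f) x <= 1)%E by rewrite /= !lee_fin; exact: f01.
have mfe : measurable_fun [set: X] (EFin \o f) by exact/measurable_EFinP.
have [] := cesaro_almost_invariant N mfe f01e.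
rewrite !UIE !RE// -!EFinD !lee_fin => i1 i2.
have h4 : `|\int[cesaro walk_law N]_x averaged f x - \int[cesaro walk_law N]_x f x| <= e / 3.
  apply: le_trans h3; rewrite ler_norml; apply/andP; split.
      by rewrite lerBrDl lerBlDr.
    by rewrite lerBlDl.
have -> : e = e / 3 + (e / 3 + e / 3) by lra.
apply: le_trans (ler_distD (\int[cesaro walk_law N]_x averaged f x) _ _) _.
rewrite distrC; apply: lerD => //.
apply: le_trans (ler_distD (\int[cesaro walk_law N]_x f x) _ _) _.
exact: lerD.
Qed.

End existence.

(** * Continuous test functions determine a Borel probability measure *)

Definition borel_val (R : realType) : borel (I01 R) -> measurableTypeR R :=
  @I01_val R.

HB.instance Definition _ (R : realType) := @isMeasurableFun.Build _ _
  (borel (I01 R)) (measurableTypeR R) (@borel_val R) (@measurable_I01_val R).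

HB.instance Definition _ (R : realType) := @isMeasurableFun.Build _ _
  (borel (C01 R) * borel (I01 R))%type (borel (I01 R)) (@eval01 R)
  (@measurable_eval01 R).

Section test_functions.
Variable R : realType.
Local Notation X := (borel (I01 R)).

Lemma lipschitz_continuous (f : I01 R -> R) (L : R) : 0 < L ->
  (forall x y, `|f x - f y| <= L * `|I01_val x - I01_val y|) -> continuous f.
Proof.
move=> L0 fL x; apply/(@cvgrPdist_lt _ _ _ (nbhs x) (nbhs_filter x)) => e e0.
apply/nbhs_I01P; exists (e / L); first by rewrite divr_gt0.
move=> y; rewrite ltr_pdivlMr// mulrC; exact: le_lt_trans.
Qed.

(** Continuous approximation from below of the indicator of the points under [s]: it is 1 up to
    [s - 1 / (k + 1)], affine in between and 0 from [s] on, within the unit interval. *)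
Definition ramp (s : R) (k : nat) (x : I01 R) : R :=
  I01_val (clamp01 (k.+1%:R * (s - I01_val x))).

Lemma ramp_itv s k x : 0 <= ramp s k x <= 1.
Proof. exact: I01_valP. Qed.

Lemma clamp01_contract (a b : R) :
  `|I01_val (clamp01 a) - I01_val (clamp01 b)| <= `|a - b|.
Proof.
wlog ab : a b / a <= b => [H|].
  have [/H//|/ltW/H] := leP a b.
  by rewrite distrC (distrC b).
rewrite distrC (distrC a) /I01_val /=.
have H1 : Num.max 0 (Num.min 1 a) <= Num.max 0 (Num.min 1 b) :> R.
  by rewrite ge_max le_max lexx/= le_max orbC le_min ge_min lexx/= ge_min ab !orbT.
rewrite !ger0_norm ?subr_ge0//.
by case: (leP 1 a) => ?; case: (leP 1 b) => ?; case: (leP 0 a) => ?;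
  case: (leP 0 b) => ?; rewrite /Num.max ?ltr01 ?lerr; (repeat case: ifP => ?); lra.
Qed.

Lemma ramp_continuous s k : continuous (ramp s k).
Proof.
apply: (@lipschitz_continuous _ k.+1%:R) => // x y.
apply: le_trans (clamp01_contract _ _) _.
rewrite -mulrBr normrM ger0_norm//.
by rewrite (_ : s - I01_val x - (s - I01_val y) = I01_val y - I01_val x) 1?distrC//; ring.
Qed.

Lemma measurable_lt s : measurable [set x : X | (I01_val x < s)%R].
Proof.
rewrite (_ : [set x | _] = (@I01_val R : X -> R) @^-1` `]-oo, s[).
  by rewrite -[X in measurable X]setTI; exact: measurable_I01_val.
by apply/seteqP; split=> x /=; rewrite in_itv.
Qed.

(** Each [ramp s k] lies between the indicators of [B k] and [A], and the sets [B k] increase to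
    [A]. *)
Lemma le_measure_test (m1 m2 : probability X R) :
  (forall f : I01 R -> R, continuous f -> (forall x, 0 <= f x <= 1) ->
    (\int[m1]_x (f x)%:E <= \int[m2]_x (f x)%:E)%E) ->
  forall s, (m1 [set x | (I01_val x < s)%R] <= m2 [set x | (I01_val x < s)%R])%E.
Proof.
move=> m12 s; pose A : set X := [set x | (I01_val x < s)%R].
pose B k : set X := [set x | (I01_val x <= s - k.+1%:R^-1)%R].
have mB k : measurable (B k) by exact: measurable_low.
have mA : measurable A := measurable_lt s.
have mr k : measurable_fun [set: X] (EFin \o ramp s k).
  by apply/measurable_EFinP; apply: continuous_borel; exact: ramp_continuous.
have r0 k x : (0 <= (ramp s k x)%:E)%E by rewrite lee_fin; case/andP: (ramp_itv s k x).
have le k : (m1 (B k) <= m2 A)%E.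
  apply: (@le_trans _ _ (\int[m1]_x (ramp s k x)%:E)%E).
    have -> : m1 (B k) = (\int[m1]_x (\1_(B k) x)%:E)%E.
      by rewrite integral_indic// setIT.
    apply: ge0_le_integral.
    - exact: measurableT.
    - by move=> x _; rewrite lee_fin indicE.
    - by apply/measurable_EFinP; exact: measurable_indic.
    - exact: mr.
    move=> x _; rewrite lee_fin indicE.
    have [/set_mem Bx|_] := boolP (_ \in _); last by case/andP: (ramp_itv s k x).
    rewrite /ramp /I01_val /= le_max le_min lexx/=; apply/orP; right.
    by rewrite mulrC -ler_pdivrMr// div1r lerBrDr -lerBrDl.
  apply: (le_trans (m12 _ (@ramp_continuous s k) (ramp_itv s k))).
  have -> : m2 A = (\int[m2]_x (\1_A x)%:E)%E.
    by rewrite integral_indic// setIT.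
  apply: ge0_le_integral.
  - exact: measurableT.
  - by move=> x _; exact: r0.
  - exact: mr.
  - by apply/measurable_EFinP; exact: measurable_indic.
  move=> x _; rewrite lee_fin indicE; have [_|/negP nA] := boolP (_ \in _).
    by case/andP: (ramp_itv s k x).
  have sx : s <= I01_val x by rewrite leNgt; apply/negP => xs; apply: nA; exact/mem_set.
  rewrite /ramp /I01_val /= ge_max lexx/= ge_min; apply/orP; right.
  by rewrite mulr_ge0_le0// subr_le0.
have c : m1 (B k) @[k --> \oo] --> m1 (\bigcup_k B k).
  apply: nondecreasing_cvg_mu => //; first by apply: bigcup_measurable => k _.
  move=> i j ij; apply/subsetPset => x; rewrite /B /= => /le_trans; apply.
  by rewrite lerD2l lerN2 lef_pV2 ?posrE// ler_nat.
have -> : [set x | (I01_val x < s)%R] = \bigcup_k B k.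
  apply/seteqP; split=> x /=.
    move=> xs; have sx : 0 < s - I01_val x by rewrite subr_gt0.
    have [k _ /(_ k (leqnn k)) /= kx] := near_infty_natSinv_lt (PosNum sx).
    by exists k => //; rewrite /B /= lerBrDl -lerBrDr ltW.
  move=> [k _]; rewrite /B /= => /le_lt_trans; apply.
  by rewrite ltrBlDr ltrDl invr_gt0.
have -> : m2 (\bigcup_k B k) = m2 A.
  congr (m2 _); apply/seteqP; split=> x; rewrite /A /=.
    move=> [k _]; rewrite /B /= => /le_lt_trans; apply.
    by rewrite ltrBlDr ltrDl invr_gt0.
  move=> xs; have sx : 0 < s - I01_val x by rewrite subr_gt0.
  have [k _ /(_ k (leqnn k)) /= kx] := near_infty_natSinv_lt (PosNum sx).
  by exists k => //; rewrite /B /= lerBrDl -lerBrDr ltW.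
rewrite -(cvg_lim _ c)//; apply: lime_le; first by apply/cvg_ex; eexists; exact: c.
by apply: nearW => k; exact: le.
Qed.

Lemma eq_measure_test (m1 m2 : probability X R) :
  (forall f : I01 R -> R, continuous f -> (forall x, 0 <= f x <= 1) ->
    (\int[m1]_x (f x)%:E = \int[m2]_x (f x)%:E)%E) ->
  forall A, measurable A -> m1 A = m2 A.
Proof.
move=> m12 A mA.
have lt12 s : m1 [set x | (I01_val x < s)%R] = m2 [set x | (I01_val x < s)%R].
  by apply/eqP; rewrite eq_le !le_measure_test// => f cf f01; rewrite m12.
(* Writing [A] as a preimage moves the comparison to image measures on the line, where open
   half-lines form a generating pi-system. *)
have AE : A = @borel_val R @^-1` (@borel_clamp01 R @^-1` A).
  by apply/seteqP; split=> x; rewrite /= /borel_clamp01 /borel_val clamp01K.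
have mcA : measurable (@borel_clamp01 R @^-1` A).
  by rewrite -[X in measurable X]setTI; exact: (@measurable_clamp01 R).
rewrite AE.
apply: (@measure_unique _ R (measurableTypeR R) (@RGenInftyO.G R)
  (fun n => `]-oo, n%:R[%classic) _ _ _ _ (distribution m1 (@borel_val R))
  (distribution m2 (@borel_val R))) => //.
- exact: RGenInftyO.measurableE.
- move=> _ _ [x ->] [y ->]; exists (Num.min x y).
  by apply/seteqP; split=> t /=; rewrite !in_itv/= lt_min => /andP.
- by move=> n; exists n%:R.
- apply/seteqP; split=> // x _; exists (Num.truncn `|x|).+1 => //=.
  by rewrite in_itv/=; exact: le_lt_trans (ler_norm _) (truncnS_gt _).
- move=> _ [x ->].
  have xE : @borel_val R @^-1` `]-oo, x[%classic = [set t | (I01_val t < x)%R].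
    by apply/seteqP; split=> t /=; rewrite in_itv.
  suff : m1 (@borel_val R @^-1` `]-oo, x[%classic) =
         m2 (@borel_val R @^-1` `]-oo, x[%classic) by [].
  by rewrite xE.
- by move=> n; rewrite -ge0_fin_numE ?measure_ge0//; exact: fin_num_measure.
Qed.

End test_functions.

(** * Existence and uniqueness of invariant measures *)

Section invariant_measures.
Variable R : realType.
Local Notation X := (borel (I01 R)).
Local Notation C := (borel (C01 R)).
Variables (mu : probability C R) (P : probability (seq_space C) R).
Hypothesis P_product : is_product_measure mu P.
Hypothesis P_bounded : (0 < P (bounded_prefix_variation mu))%E.

(** The definition integrates over the support only, the product measure over all maps; they agree
    because the support has full measure. *)
Lemma invariant_measureP (nu : probability X R) :
  invariant_measure mu nu <-> stationary mu (@eval01 R) nu.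
Proof.
have mS := measurable_supp mu.
have S1 := supp_full P_product P_bounded.
have SC : mu (~` (supp mu : set C)) = 0%E by rewrite probability_setC// S1 subee.
have E (A : set X) : measurable A -> (\int[mu]_(g in supp mu) nu ((g : C01 R) @^-1` A))%E =
    (mu \x nu)%E (@eval01 R @^-1` A).
  move=> mA; have mE : measurable (@eval01 R @^-1` A).
    exact: (measurable_preimage_ev (@measurable_eval01 R)).
  have mx : measurable_fun [set: C] (fun g => nu (xsection (@eval01 R @^-1` A) g)).
    exact: (@measurable_fun_xsection _ _ C X R nu _ mE).
  have xE g : xsection (@eval01 R @^-1` A) g = (g : C01 R) @^-1` A.
    by apply/seteqP; split=> x; rewrite /xsection /= inE.
  rewrite [RHS](@ge0_negligible_integral _ _ _ mu setT (~` (supp mu : set C)))//.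
    rewrite setTD setCK; apply: eq_integral => g _ /=; by rewrite xE.
  exact: measurableC.
by split=> H A mA; rewrite ?E ?H// -E// -H.
Qed.

(** The law [nu'] of one random step from [nu] gives the same integrals to continuous test functions
    as [nu], hence is equal to it on Borel sets. *)
Lemma ex_invariant_measure : exists nu : probability X R, invariant_measure mu nu.
Proof.
have [nu nuE] := ex_averaging_measure P_product.
exists nu; apply/invariant_measureP => A mA.
pose pr : probability (C * X)%type R := (mu \x nu)%E.
pose nu' : probability X R := distribution pr (@eval01 R).
suff : nu' A = nu A by [].
apply: eq_measure_test mA => f cf f01.
have mf : measurable_fun [set: X] (EFin \o f).
  by apply/measurable_EFinP; exact: continuous_borel.
have f0 x : (0 <= (EFin \o f) x)%E by rewrite lee_fin; case/andP: (f01 x).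
rewrite -nuE// (integral_markov_op mu (@measurable_eval01 R))//.
by rewrite ge0_integral_distribution.
Qed.

Lemma invariant_measure_unique (r : I01 R -> R) (nu1 nu2 : probability X R) A :
  (forall x y, `|r x - r y| = `|I01_val x - I01_val y|) ->
  (forall x, 0 <= r x <= 1) ->
  (forall s : R, 0 <= s <= 1 -> exists x, r x = s) ->
  (forall x, 0 < r x < 1 -> exists2 g : C01 R, supp mu g & r (g x) < r x) ->
  (forall x y, r x < r y -> I01_val x < I01_val y) \/
  (forall x y, r x < r y -> I01_val y < I01_val x) ->
  (forall x, (0 < I01_val x < 1) = (0 < r x < 1)) ->
  nu1 (@open_I01 R) = 1%E -> nu2 (@open_I01 R) = 1%E ->
  invariant_measure mu nu1 -> invariant_measure mu nu2 ->
  measurable A -> nu1 A = nu2 A.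
Proof.
move=> r_isom r_itv r_surj r_move r_mono r_open o1 o2 /invariant_measureP i1
  /invariant_measureP i2 mA.
have rE : @open_I01 R = [set x | 0 < r x < 1].
  by apply/seteqP; split=> x; rewrite /open_I01 /= r_open.
have mo : measurable (@open_I01 R : set X).
  rewrite rE (_ : [set x | _] = [set x | 0 < r x] `&` [set x | r x < 1]).
    by apply: measurableI; [exact: measurable_r_gt|exact: measurable_r_lt].
  by apply/seteqP; split=> x /=; [move/andP|case=> -> ->].
have null (nu : probability X R) t : nu (@open_I01 R) = 1%E -> (t == 0) || (t == 1) ->
    nu [set x | r x = t] = 0%E.
  move=> o t01; have oC : nu (~` (@open_I01 R : set X)) = 0%E.
    by rewrite probability_setC// o subee.
  apply/eqP; rewrite eq_le measure_ge0 andbT -oC.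
  apply: le_measure; rewrite ?inE; [exact: measurable_r_eq|exact: measurableC|].
  move=> x /= xt; rewrite rE /= xt.
  by case/orP: t01 => /eqP ->; rewrite ltxx ?andbF.
apply: (stationary_unique r_isom r_itv r_surj r_move r_mono P_product) => //.
- by apply: null => //; rewrite eqxx.
- by apply: null => //; rewrite eqxx orbT.
- by apply: null => //; rewrite eqxx.
- by apply: null => //; rewrite eqxx orbT.
Qed.

Hypothesis U1_or_U2 :
    (forall x : I01 R, open_I01 x ->
       exists g : C01 R, supp mu g /\ I01_val (g x) < I01_val x) \/
    (forall x : I01 R, open_I01 x ->
       exists g : C01 R, supp mu g /\ I01_val x < I01_val (g x)).

Lemma open_invariant_measure_unique (nu1 nu2 : probability X R) :
  nu1 (@open_I01 R) = 1%E -> nu2 (@open_I01 R) = 1%E ->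
  invariant_measure mu nu1 -> invariant_measure mu nu2 ->
  same_borel_measure nu1 nu2.
Proof.
move=> o1 o2 i1 i2 A mA; case: U1_or_U2 => move_pt.
  apply: (@invariant_measure_unique (@I01_val R)) => //.
  - by move=> x; exact: I01_valP.
  - by move=> s s01; exists (clamp01 s); rewrite clamp01_val.
  - by move=> x /move_pt[g [? ?]]; exists g.
  - by left.
apply: (@invariant_measure_unique (fun x => 1 - I01_val x)) => //.
- move=> x y.
  by rewrite (_ : 1 - I01_val x - (1 - I01_val y) = I01_val y - I01_val x) 1?distrC//; ring.
- by move=> x; have := I01_valP x; rewrite subr_ge0 lerBlDr lerDl andbC.
- move=> s /andP[s0 s1]; exists (clamp01 (1 - s)).
  rewrite clamp01_val; first exact: subKr.
  by rewrite subr_ge0 s1 gerBl.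
- move=> x; rewrite subr_gt0 ltrBlDr ltrDl andbC => /move_pt[g [? xg]].
  by exists g => //; rewrite ltrD2l ltrN2.
- by right => x y; rewrite ltrD2l ltrN2.
- by move=> x; rewrite subr_gt0 ltrBlDr ltrDl andbC.
Qed.

End invariant_measures.

Theorem corollary1p2 (R : realType)
  (mu : probability (borel (C01 R)) R)
  (muN : probability (seq_space (borel (C01 R))) R)
  (muN_product : is_product_measure mu muN)
  (muN_bounded : (0 < muN (bounded_prefix_variation mu))%E)
  (U1_or_U2 :
    (forall x : I01 R, open_I01 x ->
       exists g : C01 R, supp mu g /\ I01_val (g x) < I01_val x) \/
    (forall x : I01 R, open_I01 x ->
       exists g : C01 R, supp mu g /\ I01_val x < I01_val (g x))) :
  (forall nu1 nu2 : probability (borel (I01 R)) R,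
     nu1 (@open_I01 R) = 1%E -> nu2 (@open_I01 R) = 1%E ->
     invariant_measure mu nu1 -> invariant_measure mu nu2 ->
     same_borel_measure nu1 nu2) /\
  ((forall nu : probability (borel (I01 R)) R, invariant_measure mu nu ->
      nu [set x : I01 R | I01_val x = 0] = 0%E /\
      nu [set x : I01 R | I01_val x = 1] = 0%E) ->
   uniquely_ergodic mu).
Proof.
have uniq := open_invariant_measure_unique muN_product muN_bounded U1_or_U2.
split=> // no_atom.
have m_val (A : set R) : measurable A ->
    measurable ((@I01_val R : borel (I01 R) -> R) @^-1` A).
  by move=> mA; rewrite -[X in measurable X]setTI; exact: measurable_I01_val.
have m01 t : measurable ([set x : I01 R | I01_val x = t] : set (borel (I01 R))).
  exact: (m_val [set t]).
have opn (nu : probability (borel (I01 R)) R) : invariant_measure mu nu ->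
    nu (@open_I01 R) = 1%E.
  move=> /no_atom[n0 n1].
  have oE : (@open_I01 R : set (borel (I01 R))) =
      ~` ([set x : I01 R | I01_val x = 0] `|` [set x : I01 R | I01_val x = 1]).
    apply/seteqP; split=> x; rewrite /open_I01 /=.
      by move=> /andP[x0 x1] [] xe; move: x0 x1; rewrite xe ltxx.
    have /andP[x0 x1] := I01_valP x.
    by move=> /not_orP[/eqP n /eqP n']; rewrite !lt_neqAle x0 x1 eq_sym n n'.
  rewrite oE probability_setC; last exact: measurableU.
  rewrite (_ : nu (_ `|` _) = 0%E) ?sube0//.
  apply/eqP; rewrite eq_le measure_ge0 andbT.
  apply: (le_trans (measureU2 _ (m01 0) (m01 1))).
  by rewrite [X in (X + _)%E]n0 [X in (_ + X)%E]n1 adde0.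
have [nu inu] := ex_invariant_measure muN_product muN_bounded.
exists nu; split => // nu' inu'.
by apply: uniq => //; exact: opn.
Qed.
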